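(* Let $a<b$, $0<\alpha,\beta<1$, and let $L:[a,b]\times\mathbb R^3\to\mathbb R$, $(x,y,u,v)\mapsto L(x,y,u,v)$, be of class $C^1$. Suppose that $L(\underline x,y,u,v)$ is convex in $[a,b]\times\mathbb R^3$. Let $y_0\in{}_a^{\alpha}E_b^{\beta}$ be such that $\partial_3L[y_0]$ has a continuous right Riemann--Liouville derivative of order $\alpha$ and $\partial_4L[y_0]$ has a continuous left Riemann--Liouville derivative of order $\beta$ on $[a,b]$, and suppose $y_0$ is a solution of the fractional Euler--Lagrange equation $$\partial_2 L[y_0](x)+{}_xD_b^\alpha\, \partial_3 L[y_0](x)+{}_aD_x^\beta\, \partial_4 L[y_0](x)=0,\qquad x\in[a,b].$$ Then $y_0$ minimizes $$J(y)=\int_a^b L[y](x)\,dx$$ over all $y\in{}_a^{\alpha}E_b^{\beta}$ satisfying the boundary conditions $y(a)=y_0(a)$ and $y(b)=y_0(b)$.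
   Context: Fractional operators. Let $0<\gamma<1$ and let $\Gamma$ be the Euler gamma function. The left and right Riemann--Liouville derivatives of order $\gamma$ are $${}_aD_x^\gamma f(x)=\frac{1}{\Gamma(1-\gamma)}\frac{d}{dx}\int_a^x (x-t)^{-\gamma}f(t)\,dt,\qquad {}_xD_b^\gamma f(x)=\frac{-1}{\Gamma(1-\gamma)}\frac{d}{dx}\int_x^b (t-x)^{-\gamma}f(t)\,dt$$ (one-sided derivatives at endpoints). The left and right Caputo derivatives are, for absolutely continuous $f:[a,b]\to\mathbb R$, $${}_a^CD_x^\gamma f(x)=\frac{1}{\Gamma(1-\gamma)}\int_a^x (x-t)^{-\gamma}f'(t)\,dt,\qquad {}_x^CD_b^\gamma f(x)=\frac{-1}{\Gamma(1-\gamma)}\int_x^b (t-x)^{-\gamma}f'(t)\,dt,$$ with the value at $x=a$ (left) or $x=b$ (right) understood as the limit. Function space: ${}_a^{\alpha}E_b^{\beta}$ is the set of $y:[a,b]\to\mathbb R$ for which ${}_a^CD_x^\alpha y$ and ${}_x^CD_b^\beta y$ exist and are continuous on $[a,b]$. Notation: $[y](x)=(x,y(x),{}_a^CD_x^\alpha y(x),{}_x^CD_b^\beta y(x))$; $L[y](x)=L([y](x))$; $\partial_i$ is the partial derivative with respect to the $i$-th variable of a function of $(x,y,u,v)$. Convexity: $f(\underline x,y,u,v)$ is convex in $S\subseteq\mathbb R^4$ if $\partial_2 f,\partial_3 f,\partial_4 f$ exist and are continuous and $$f(x,y+y_1,u+u_1,v+v_1)-f(x,y,u,v)\ge \partial_2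 f(x,y,u,v)\,y_1+\partial_3 f(x,y,u,v)\,u_1+\partial_4 f(x,y,u,v)\,v_1$$ for every $(x,y,u,v),(x,y+y_1,u+u_1,v+v_1)\in S$. *)

(* Defs.v *)
From mathcomp Require Import all_boot all_order all_algebra.
From mathcomp Require Import all_classical all_reals all_analysis.

Set Implicit Arguments.
Unset Strict Implicit.
Unset Printing Implicit Defensive.

Import Order.TTheory GRing.Theory Num.Theory.
Import numFieldNormedType.Exports.

Local Open Scope classical_set_scope.
Local Open Scope ring_scope.

(* Functions on [a, b] (resp. [a, b] x R^3) are represented by total functions
   on R (resp. R^4); every notion below depends only on the values on the
   intended domain. *)

Section FractionalOperators.
Context {R : realType}.
Implicit Types (a b x t g : R) (f : R -> R).

Local Notation mu := (@lebesgue_measure R).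

Definition gamma_fun (s : R) : R :=
  \int[mu]_(t in `]0, +oo[) (t `^ (s - 1) * expR (- t)).

(* Derivative relative to D: for D = [a, b] it is the usual derivative at
   interior points and the one-sided derivative at a and at b. *)
Definition diff_quot f x : R -> R := fun z => (f z - f x) / (z - x).

Definition derivable_in (D : set R) f x : Prop :=
  cvg (diff_quot f x @ within D x^').

Definition derive_in (D : set R) f x : R :=
  lim (diff_quot f x @ within D x^').

Definition abs_cont a b f : Prop :=
  forall e : R, 0 < e -> exists2 d : R, 0 < d &
    forall (n : nat) (s t : 'I_n -> R),
      (forall i, a <= s i /\ s i <= t i /\ t i <= b) ->
      trivIset setT (fun i => `]s i, t i[%classic) ->
      \sum_(i < n) (t i - s i) < d ->
      \sum_(i < n) `|f (t i) - f (s i)| < e.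

Definition left_kernel g f x : R -> R := fun t => (x - t) `^ (- g) * f t.

Definition right_kernel g f x : R -> R := fun t => (t - x) `^ (- g) * f t.

Definition left_int g a f x : R :=
  \int[mu]_(t in `]a, x[) left_kernel g f x t.

Definition right_int g b f x : R :=
  \int[mu]_(t in `]x, b[) right_kernel g f x t.

Definition RL_left g a b f x : R :=
  (gamma_fun (1 - g))^-1 * derive_in `[a, b] (left_int g a f) x.

Definition RL_right g a b f x : R :=
  - (gamma_fun (1 - g))^-1 * derive_in `[a, b] (right_int g b f) x.

Definition has_continuous_RL_left g a b f : Prop :=
  [/\ forall x, x \in `[a, b] ->
        mu.-integrable `]a, x[ (EFin \o left_kernel g f x),
      forall x, x \in `[a, b] -> derivable_in `[a, b] (left_int g a f) x
    & {within `[a, b], continuous (RL_left g a b f)}].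

Definition has_continuous_RL_right g a b f : Prop :=
  [/\ forall x, x \in `[a, b] ->
        mu.-integrable `]x, b[ (EFin \o right_kernel g f x),
      forall x, x \in `[a, b] -> derivable_in `[a, b] (right_int g b f) x
    & {within `[a, b], continuous (RL_right g a b f)}].

(* Away from the base point, the Caputo derivatives are given by the integral;
   here derive1 f is the pointwise derivative, which exists a.e. on ]a, b[ when f
   is absolutely continuous. *)
Definition caputo_left_raw g a f x : R :=
  (gamma_fun (1 - g))^-1 * left_int g a (derive1 f) x.

Definition caputo_right_raw g b f x : R :=
  - (gamma_fun (1 - g))^-1 * right_int g b (derive1 f) x.

(* At the base point the value is the limit, not the (empty) integral. *)
Definition caputo_left g a f x : R :=
  if x == a then lim (caputo_left_raw g a f @ a^'+)
  else caputo_left_raw g a f x.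

Definition caputo_right g b f x : R :=
  if x == b then lim (caputo_right_raw g b f @ b^'-)
  else caputo_right_raw g b f x.

Definition has_continuous_caputo_left g a b f : Prop :=
  [/\ forall x, x \in `]a, b] ->
        mu.-integrable `]a, x[ (EFin \o left_kernel g (derive1 f) x),
      cvg (caputo_left_raw g a f @ a^'+)
    & {within `[a, b], continuous (caputo_left g a f)}].

Definition has_continuous_caputo_right g a b f : Prop :=
  [/\ forall x, x \in `[a, b[ ->
        mu.-integrable `]x, b[ (EFin \o right_kernel g (derive1 f) x),
      cvg (caputo_right_raw g b f @ b^'-)
    & {within `[a, b], continuous (caputo_right g b f)}].

Definition frac_space (al be a b : R) : set (R -> R) :=
  [set y | [/\ abs_cont a b y,
               has_continuous_caputo_left al a b y
             & has_continuous_caputo_right be a b y]].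

End FractionalOperators.

Section Lagrangian.
Context {R : realType}.

Implicit Types (L : R * R * R * R -> R) (p : R * R * R * R).

Definition slice1 L p (z : R) : R := let: (_, y, u, v) := p in L (z, y, u, v).
Definition slice2 L p (z : R) : R := let: (x, _, u, v) := p in L (x, z, u, v).
Definition slice3 L p (z : R) : R := let: (x, y, _, v) := p in L (x, y, z, v).
Definition slice4 L p (z : R) : R := let: (x, y, u, _) := p in L (x, y, u, z).

(* The first variable ranges over [a, b] only, hence a one-sided partial
   derivative at its endpoints. *)
Definition partial1 (a b : R) L p : R :=
  derive_in `[a, b] (slice1 L p) p.1.1.1.
Definition partial2 L p : R := derive1 (slice2 L p) p.1.1.2.
Definition partial3 L p : R := derive1 (slice3 L p) p.1.2.
Definition partial4 L p : R := derive1 (slice4 L p) p.2.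

Definition has_partial1 (a b : R) L p : Prop :=
  derivable_in `[a, b] (slice1 L p) p.1.1.1.
Definition has_partial2 L p : Prop := derivable (slice2 L p) p.1.1.2 1.
Definition has_partial3 L p : Prop := derivable (slice3 L p) p.1.2 1.
Definition has_partial4 L p : Prop := derivable (slice4 L p) p.2 1.

Definition strip (a b : R) : set (R * R * R * R) :=
  [set p | p.1.1.1 \in `[a, b]].

Definition continuous_partials234 (S : set (R * R * R * R)) L : Prop :=
  (forall p, S p -> [/\ has_partial2 L p, has_partial3 L p & has_partial4 L p])
  /\ [/\ {within S, continuous (partial2 L)},
         {within S, continuous (partial3 L)}
       & {within S, continuous (partial4 L)}].

Definition C1_on_strip (a b : R) L : Prop :=
  [/\ {within strip a b, continuous L},
      forall p, strip a b p -> has_partial1 a b L p,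
      {within strip a b, continuous (partial1 a b L)}
    & continuous_partials234 (strip a b) L].

Definition convex_yuv (S : set (R * R * R * R)) L : Prop :=
  continuous_partials234 S L /\
  forall x y u v y1 u1 v1 : R,
    S (x, y, u, v) -> S (x, y + y1, u + u1, v + v1) ->
    partial2 L (x, y, u, v) * y1 + partial3 L (x, y, u, v) * u1
      + partial4 L (x, y, u, v) * v1
    <= L (x, y + y1, u + u1, v + v1) - L (x, y, u, v).

Definition bracket (al be a b : R) (y : R -> R) (x : R) : R * R * R * R :=
  (x, y x, caputo_left al a y x, caputo_right be b y x).

Definition J_functional (al be a b : R) L (y : R -> R) : R :=
  \int[@lebesgue_measure R]_(x in `[a, b]) L (bracket al be a b y x).

End Lagrangian.

(* Main.v *)
(* By convexity, J y - J y0 is at least the difference of the integrals over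
   [a, b] of
     f2 w + f3 (left Caputo derivative of w) + f4 (right Caputo derivative of w)
   at w = y and at w = y0, where f2, f3, f4 are the partial derivatives of L
   along y0.  Fractional integration by parts turns this integral into a
   boundary term depending only on w a and w b, plus the integral of w times the
   left-hand side of the Euler-Lagrange equation, which vanishes; hence the two
   integrals agree.  Applying this to y and y0 separately avoids differentiating
   y - y0.

   Fractional integration by parts is Fubini for the weakly singular kernel
   |x - t|^(-g), followed by ordinary integration by parts of w against a C^1
   fractional integral.  The latter is again Fubini, given that an absolutely
   continuous function is the integral of its a.e. derivative.  To see this, let
   V be the total variation of w: V and V - w are nondecreasing and absolutely
   continuous, so their Lebesgue-Stieltjes measures are dominated by the Lebesgue
   measure; take the Radon-Nikodym densities and differentiate by Lebesgue's
   theorem. *)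
From HB Require Import structures.
Require Import Defs.
From mathcomp Require Import all_boot all_order all_algebra.
From mathcomp Require Import all_classical all_reals all_analysis.
From mathcomp Require Import measurable_realfun ring lra.
Import Order.TTheory GRing.Theory Num.Theory.
Import numFieldNormedType.Exports.
Set Implicit Arguments.
Unset Strict Implicit.
Unset Printing Implicit Defensive.
Local Open Scope classical_set_scope.
Local Open Scope ring_scope.

(** * Absolutely continuous functions and their densities *)

(** Projection onto [[a, b]] when [a <= b]; composing with it extends a function on the segment to
    the whole line, constant on each side. *)
Definition clamp {R : realType} (a b x : R) : R := Num.max a (Num.min x b).

Section clamp_lemmas.
Context {R : realType}.
Implicit Types a b x y : R.

Lemma clamp_ge a b x : a <= clamp a b x.
Proof. by rewrite /clamp le_max lexx. Qed.

Lemma clamp_le a b x : a <= b -> clamp a b x <= b.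
Proof. by move=> ab; rewrite /clamp ge_max ab ge_min lexx orbT. Qed.

Lemma clamp_id a b x : a <= x <= b -> clamp a b x = x.
Proof. by case/andP=> ax xb; rewrite /clamp (min_idPl xb) (max_idPr ax). Qed.

Lemma clamp_homo a b : {homo clamp a b : x y / x <= y}.
Proof.
move=> x y xy; rewrite /clamp ge_max le_max lexx/= le_max; apply/orP; right.
by rewrite le_min !ge_min xy lexx !orbT.
Qed.

Lemma clamp_dist a b x y : x <= y -> clamp a b y - clamp a b x <= y - x.
Proof.
by move=> xy; rewrite /clamp !minEle !maxEle; do !case: ifPn; rewrite -?ltNge; lra.
Qed.

Lemma clamp_oo a b x y :
  a <= b -> `]clamp a b x, clamp a b y[%classic `<=` `]x, y[%classic.
Proof.
move=> ab z /=; rewrite !in_itv/= => /andP[+ +].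
by rewrite /clamp !minEle !maxEle; do !case: ifPn; rewrite -?ltNge; lra.
Qed.

End clamp_lemmas.

(* [abs_cont] on the whole line, with families indexed by any finite type: sigma
   types are needed to glue partitions of several intervals together. *)
Definition abs_contR {R : realType} (f : R -> R) : Prop :=
  forall e : R, 0 < e -> exists2 d : R, 0 < d &
    forall (T : finType) (s t : T -> R), (forall i, s i <= t i) ->
      trivIset setT (fun i => `]s i, t i[%classic) ->
      \sum_i (t i - s i) < d -> \sum_i `|f (t i) - f (s i)| < e.

Section absolute_continuity.
Context {R : realType}.
Implicit Types (a b x y : R) (f g : R -> R).

(** Clamping lengthens no interval, and the open interval between two clamped endpoints lies in the
    original one, so a disjoint family stays disjoint. *)
Lemma abs_contR_clamp a b f : a <= b ->
  abs_cont a b f -> abs_contR (f \o clamp a b).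
Proof.
move=> ab acf e e0; have [d d0 H] := acf e e0; exists d => // T s t st tr sd.
(* [abs_cont] speaks of families indexed by ordinals, so [T] is enumerated. *)
have bij := onW_bij xpredT (@enum_val_bij T).
rewrite (reindex _ bij)/=.
have /= := H #|T| (fun k => clamp a b (s (enum_val k)))
                  (fun k => clamp a b (t (enum_val k))).
apply.
- move=> i; split; first exact: clamp_ge.
  by split; [apply: clamp_homo; exact: st|exact: clamp_le].
- move=> i j _ _ [z [zi zj]]; apply: enum_val_inj.
  by apply: tr => //; exists z; split; [move: zi|move: zj]; apply: clamp_oo.
- apply: le_lt_trans sd.
  rewrite [leRHS](reindex _ bij)/=.
  by apply: ler_sum => i _; exact: clamp_dist.
Qed.

Lemma abs_contRB f g : abs_contR f -> abs_contR g -> abs_contR (f \- g).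
Proof.
move=> acf acg e e0; have e20 : 0 < e / 2 by rewrite divr_gt0.
have [d1 d10 H1] := acf _ e20; have [d2 d20 H2] := acg _ e20.
exists (Num.min d1 d2); first by rewrite lt_min d10.
move=> T s t st tr; rewrite lt_min => /andP[s1 s2].
apply: le_lt_trans (_ : \sum_i (`|f (t i) - f (s i)| + `|g (t i) - g (s i)|) < _).
  apply: ler_sum => i _ /=; have -> : f (t i) - g (t i) - (f (s i) - g (s i)) =
      (f (t i) - f (s i)) - (g (t i) - g (s i)) by ring.
  exact: ler_normB.
by rewrite big_split/= [ltRHS]splitr ltrD ?H1 ?H2.
Qed.

Lemma abs_contR_continuous f : abs_contR f -> continuous f.
Proof.
move=> acf x; apply/cvgrPdist_lt => e e0; have [d d0 H] := acf e e0.
apply/nbhs_ballP; exists d => //= y; rewrite /ball/= => xyd.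
have key u v : u <= v -> `|u - v| < d -> `|f u - f v| < e.
  move=> uv uvd; have := H unit (fun=> u) (fun=> v) (fun=> uv).
  rewrite !big_const card_unit /= !addr0 distrC; apply; first by case=> [[]].
  by rewrite -[ltLHS]ger0_norm ?subr_ge0// distrC.
case: (leP x y) => [xy|/ltW yx]; first exact: key.
by rewrite distrC key// distrC.
Qed.

(** The cells of all the partitions together form one disjoint family with the same total length,
    indexed by a sigma type; absolute continuity is applied to it with the same [d]. *)
Lemma abs_contR_variation f (e : R) : abs_contR f -> 0 < e ->
  exists2 d : R, 0 < d & forall (T : finType) (s t : T -> R) (p : T -> seq R),
    (forall i, s i <= t i) ->
    trivIset setT (fun i => `]s i, t i[%classic) ->
    \sum_i (t i - s i) < d ->
    (forall i, itv_partition (s i) (t i) (p i)) ->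
    \sum_i variation (s i) (t i) f (p i) < e.
Proof.
move=> acf e0; have [d d0 H] := acf e e0; exists d => // T s t p st tr sd part.
(* Index [0] is [s i] and index [size (p i)] is [t i], so cell [k] is []P i k, P i k.+1[]. *)
pose P i := nth (t i) (s i :: p i).
have Psorted i : sorted <=%R (s i :: p i).
  have [pp _] := part i; apply: (sub_sorted (@ltW _ _)); exact: pp.
have Phomo i m n : (m <= n <= size (p i))%N -> P i m <= P i n.
  by case/andP=> mn ns; apply: (le_sorted_leq_nth _ (Psorted i));
    rewrite ?inE/= ?ltnS// (leq_trans mn).
have Pge i n : (n <= size (p i))%N -> s i <= P i n.
  by move=> ns; exact: itv_partition_nth_ge (part i).
have Ple i n : (n <= size (p i))%N -> P i n <= t i.
  by move=> ns; exact: itv_partition_nth_le (part i).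
have tele i : \sum_(k < size (p i)) (P i k.+1 - P i k) = t i - s i.
  rewrite -(big_mkord xpredT (fun k => P i k.+1 - P i k)) telescope_sumr//.
  by rewrite /P (itv_partition_nth_size _ (part i)).
rewrite [ltLHS](_ : _ = \sum_i \sum_(k < size (p i)) `|f (P i k.+1) - f (P i k)|);
  last by apply: eq_bigr => i _; rewrite /variation big_mkord.
rewrite (sig_big_dep (fun=> true) (fun=> xpredT))/=.
apply: (H {i : T & 'I_(size (p i))} (fun u => P (tag u) (tagged u))
  (fun u => P (tag u) (tagged u).+1)).
- by move=> [i k]/=; apply: Phomo; rewrite leqnSn/=.
- move=> [i k] [j l] _ _ [z [/=]]; rewrite !in_itv/= => /andP[z1 z2] /andP[z3 z4].
  (* A common point of two cells also lies in both enclosing intervals, which are disjoint unless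
     [i = j]. *)
  have ij : i = j.
    apply: tr => //; exists z; split; rewrite /= in_itv/=; apply/andP; split.
    + by apply: le_lt_trans z1; apply: Pge; exact: ltnW.
    + by apply: lt_le_trans z2 _; exact: Ple.
    + by apply: le_lt_trans z3; apply: Pge; exact: ltnW.
    + by apply: lt_le_trans z4 _; exact: Ple.
  subst j; congr existT; apply: val_inj => /=.
  have [kl|lk|//] := ltngtP k l.
  + have := lt_le_trans z2 (@Phomo i k.+1 l _); rewrite kl ltnW// => /(_ isT).
    by move/lt_trans => /(_ _ z3); rewrite ltxx.
  + have := lt_le_trans z4 (@Phomo i l.+1 k _); rewrite lk ltnW// => /(_ isT).
    by move/lt_trans => /(_ _ z1); rewrite ltxx.
- rewrite -(sig_big_dep (fun=> true) (fun=> xpredT)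
    (fun i (k : 'I_(size (p i))) => P i k.+1 - P i k))/=.
  by under eq_bigr do rewrite tele.
Qed.

End absolute_continuity.

(** * Total variation and the Jordan decomposition *)

Section total_variation_absolute_continuity.
Context {R : realType}.
Implicit Types (a b x y : R) (f g : R -> R).

(** The bound on variations is uniform in the partitions, so it survives the supremum over them; the
    strict inequality becomes a weak one. *)
Lemma abs_contR_total_variation f (e : R) : abs_contR f -> 0 < e ->
  exists2 d : R, 0 < d & forall (T : finType) (s t : T -> R),
    (forall i, s i <= t i) ->
    trivIset setT (fun i => `]s i, t i[%classic) ->
    \sum_i (t i - s i) < d ->
    (forall i, total_variation (s i) (t i) f \is a fin_num) /\
    \sum_i fine (total_variation (s i) (t i) f) <= e.
Proof.
move=> acf e0; have [d d0 H] := abs_contR_variation acf e0.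
exists d => // T s t st tr sd.
(* Partitions are strictly increasing, so a degenerate interval has only the empty one. *)
pose q i : seq R := if s i == t i then [::] else [:: t i].
have qP i : itv_partition (s i) (t i) (q i).
  rewrite /q; case: eqVneq => [->|sti]; first by split => //=.
  by apply: itv_partition1; rewrite lt_neqAle sti st.
have fin i : total_variation (s i) (t i) f \is a fin_num.
  rewrite ge0_fin_numE ?total_variation_ge0//.
  apply: (@le_lt_trans _ _ e%:E); last exact: ltry.
  (* Any partition [p] of the [i]-th interval, completed by trivial partitions elsewhere,
     contributes one term of a nonnegative sum below [e]. *)
  apply: ge_ereal_sup => _ [_ [p pP <-] <-]; rewrite lee_fin.
  have Hp j : itv_partition (s j) (t j) (if j == i then p else q j).
    by case: eqVneq => [->|_]; [exact: pP|exact: qP].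
  apply/ltW/(le_lt_trans _ (H T s t _ st tr sd Hp)).
  rewrite (bigD1 i)//= eqxx lerDl; apply: sumr_ge0 => j _.
  exact: variation_ge0.
split => //; apply/ler_addgt0Pr => h h0.
pose n := #|T|.
(* Near-optimal partitions: an error [h / n.+1%:R] for each of the [n] indices adds up to at most
   [h], and the successor covers an empty [T]. *)
have hn0 : 0 < h / n.+1%:R by rewrite divr_gt0.
have ex i : exists p, itv_partition (s i) (t i) p /\
    fine (total_variation (s i) (t i) f) - h / n.+1%:R
      < variation (s i) (t i) f p.
  have [_ [_ [p pP <-] <-]] := ub_ereal_sup_adherent hn0 (fin i).
  rewrite -/(total_variation (s i) (t i) f) -(fineK (fin i)) -EFinB lte_fin => ?.
  by exists p; split.
have /choice[p pP] := ex.
have := H T s t p st tr sd (fun i => (pP i).1) => /ltW Hp.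
rewrite -lerBlDr (le_trans _ Hp)//.
apply: (@le_trans _ _ (\sum_i (fine (total_variation (s i) (t i) f) - h / n.+1%:R))).
  rewrite sumrB lerD2l lerN2 sumr_const -[leLHS]mulr_natr -/n.
  by rewrite -mulrA ler_piMr ?(ltW h0)// mulrC ler_pdivrMr// mul1r ler_nat.
by apply: ler_sum => i _; apply/ltW; exact: (pP i).2.
Qed.

(** Intervals shorter than [d] have finite variation; additivity carries this along steps of length
    [d / 2], and the Archimedean property reaches [y]. *)
Lemma abs_contR_total_variation_fin_num f x y : abs_contR f -> x <= y ->
  total_variation x y f \is a fin_num.
Proof.
move=> acf xy; have [d d0 H] := abs_contR_total_variation acf (@ltr01 R).
have small u v : u <= v -> v - u < d -> total_variation u v f \is a fin_num.
  move=> uv uvd; have [||+ _] := H unit (fun=> u) (fun=> v) (fun=> uv).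
  - by case=> [[]].
  - by rewrite big_const card_unit/= addr0.
  - by apply; exact: tt.
have d20 : 0 < d / 2 by rewrite divr_gt0.
have step k : total_variation x (x + k%:R * (d / 2)) f \is a fin_num.
  elim: k => [|k ih]; first by rewrite mul0r addr0 total_variationxx.
  rewrite (@total_variationD _ _ _ (x + k%:R * (d / 2))).
  - rewrite fin_numD ih/=; apply: small; first by rewrite lerD2l ler_wpM2r ?ler_nat ?ltW.
    by rewrite -natr1; lra.
  - by rewrite lerDl mulr_ge0 // ltW.
  - by rewrite lerD2l ler_wpM2r ?ler_nat ?ltW.
pose k := Num.bound ((y - x) / (d / 2)).
have kP : y <= x + k%:R * (d / 2).
  rewrite -lerBlDl -ler_pdivrMr//; apply/ltW/archi_boundP.
  by rewrite divr_ge0 ?subr_ge0// ltW.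
have := step k; rewrite (total_variationD _ xy kP).
by rewrite fin_numD => /andP[].
Qed.

(** Jordan decomposition of the clamped function [g]: [V] is its variation from [a], whose
    increments are the variations on subintervals, and [N] is [V - g]. *)
Lemma abs_cont_decomposition a b f : a <= b -> abs_cont a b f ->
  exists V N : R -> R,
    [/\ nondecreasing V, nondecreasing N, abs_contR V, abs_contR N
      & forall x, a <= x <= b -> f x = V x - N x].
Proof.
move=> ab acf; have acg := abs_contR_clamp ab acf.
set g := f \o clamp a b in acg.
have fin x y : x <= y -> total_variation x y g \is a fin_num.
  exact: abs_contR_total_variation_fin_num.
pose V x := fine (total_variation a (clamp a b x) g).
have VB x y : x <= y ->
    V y - V x = fine (total_variation (clamp a b x) (clamp a b y) g).
  move=> xy; rewrite /V (@total_variationD _ a (clamp a b y) (clamp a b x)).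
  - rewrite fineD ?fin ?clamp_ge ?clamp_homo//; ring.
  - exact: clamp_ge.
  - exact: clamp_homo.
have TVge0 x y : x <= y ->
    0 <= fine (total_variation (clamp a b x) (clamp a b y) g).
  by move=> xy; apply/fine_ge0/total_variation_ge0; exact: clamp_homo.
have gK x : g (clamp a b x) = g x.
  by rewrite /g/= [clamp _ _ (clamp _ _ _)]clamp_id// clamp_ge clamp_le.
have acV : abs_contR V.
  move=> e e0; have e20 : 0 < e / 2 by rewrite divr_gt0.
  have [d d0 H] := abs_contR_total_variation acg e20.
  exists d => // T s t st tr sd.
  have [|||_] := H T (fun i => clamp a b (s i)) (fun i => clamp a b (t i)).
  - by move=> i; exact: clamp_homo.
  - move=> i j _ _ [z [zi zj]].
    by apply: tr => //; exists z; split; [move: zi|move: zj]; apply: clamp_oo.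
  - by apply: le_lt_trans sd; apply: ler_sum => i _; exact: clamp_dist.
  move=> le2; apply: (@le_lt_trans _ _ (e / 2)); last by rewrite ltr_pdivrMr// ltr_pMr// ltr1n.
  apply: le_trans le2; apply: ler_sum => i _.
  by rewrite VB// ger0_norm// TVge0.
exists V, (V \- g); split => //.
- by move=> x y xy; rewrite -subr_ge0 VB// TVge0.
- move=> x y xy; rewrite -subr_ge0.
  have -> : (V \- g) y - (V \- g) x = (V y - V x) - (g y - g x).
    by rewrite /=; ring.
  (* The increment of [g] on an interval is at most its variation there, so [V - g] is
     nondecreasing. *)
  rewrite VB// -(gK x) -(gK y) subr_ge0 -lee_fin fineK ?fin ?clamp_homo//.
  apply: le_trans (total_variation_ge _ _); last exact: clamp_homo.
  by rewrite lee_fin ler_norm.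
- exact: abs_contRB.
- by move=> x xab; rewrite /= subKr /g /= clamp_id.
Qed.

End total_variation_absolute_continuity.

(** * Stieltjes measures and Radon-Nikodym densities *)

Section stieltjes_density.
Context {R : realType}.
Implicit Types (a b x y : R) (G : R -> R).
Local Notation mu := (@lebesgue_measure R).

Lemma lebesgue_stieltjes_itv_oc (G : cumulative R R) x y : x <= y ->
  lebesgue_stieltjes_measure G `]x, y]%classic = (G y - G x)%:E.
Proof.
move=> xy; rewrite /lebesgue_stieltjes_measure /measure_extension.
by rewrite measurable_mu_extE/=; [rewrite wlength_itv_bnd|exact: is_ocitv].
Qed.

(** Finite measure excludes unbounded intervals and openness excludes attained endpoints; the empty
    set is a degenerate []s, s[]. *)
Lemma open_interval_oo (I : set R) : open I -> is_interval I ->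
  (mu I < +oo)%E -> exists s t, s <= t /\ I = `]s, t[%classic.
Proof.
move=> oI /is_intervalP I_itv.
have [I0 _|I0] := eqVneq I set0; first by exists 0, 0; rewrite set_itv_ge ?bnd_simp.
rewrite [X in mu X]I_itv lebesgue_measure_itv.
case: (Rhull I) I_itv => [[b1 s|[]] [b2 t|[]]] I_itv //=.
- move=> _; have IE : I = `]s, t[%classic.
    by rewrite -(interior_itv_bnd _ _ b1 b2) -I_itv; exact/esym/interior_id.
  have [st|/ltW ts] := leP s t; first by exists s, t.
  by exists s, s; split => //; rewrite IE !set_itv_ge// bnd_simp -leNgt.
- by move: I0; rewrite I_itv set_itv_ge ?eqxx.
- by rewrite ltry.
- by rewrite ltNyr.
- by move: I0; rewrite I_itv set_itv_ge ?eqxx.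
all: by move: I0; rewrite I_itv set_itv_ge ?eqxx.
Qed.

(** Outer regularity puts a null set inside an open set of Lebesgue measure below [d]. The disjoint
    intervals composing it have total length below [d], so absolute continuity bounds every finite
    sum of increments of [G], and countable additivity passes to the limit. *)
Lemma abs_contR_stieltjes_dominated (G : cumulative R R) : abs_contR G ->
  content_dominates mu (lebesgue_stieltjes_measure G).
Proof.
move=> acG A mA A0; apply/eqP; rewrite eq_le measure_ge0 andbT.
apply/lee_addgt0Pr => e e0; rewrite add0e.
have [d d0 H] := acG e e0.
have [|U [oU AU UA]] := @lebesgue_regularity_outer R A d mA _ d0.
  by rewrite A0.
have mU : measurable U by exact: open_measurable.
have Ud : (mu U < d%:E)%E.
  have mUA : measurable (U `\` A) by exact: measurableD.
  apply: le_lt_trans UA; rewrite -{1}(setDKU AU).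
  apply: (le_trans (measureU2 mu mUA mA)).
  by rewrite [X in (_ + X <= _)%E](_ : _ = 0%E)// adde0.
pose I := open_disjoint_itv oU.
have mI k : measurable (I k) by apply: open_measurable; exact: open_disjoint_itv_open.
have IU k : I k `<=` U.
  by rewrite (open_disjoint_itv_bigcup oU); exact: bigcup_sup.
have tI : trivIset setT I by exact: open_disjoint_itv_trivIset.
have stP k : exists u : R * R, u.1 <= u.2 /\ I k = `]u.1, u.2[%classic.
  have IkU : (mu (I k) < +oo)%E.
    apply: (@le_lt_trans _ _ (mu U)).
      by apply: le_measure; rewrite ?inE//; exact: mI.
    by apply: lt_trans Ud _; exact: ltry.
  have [s [t [st IE]]] := open_interval_oo (@open_disjoint_itv_open _ _ oU k)
    (@open_disjoint_itv_is_interval _ _ oU k) IkU.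
  by exists (s, t).
have [st {}stP] := choice stP.
apply: (@le_trans _ _ (lebesgue_stieltjes_measure G U)).
  by apply: le_measure; rewrite ?inE//; exact: mU.
rewrite [X in lebesgue_stieltjes_measure G X](open_disjoint_itv_bigcup oU).
rewrite measure_semi_bigcup//; last by apply: bigcup_measurable => k _; exact: mI.
apply: lime_le; first by apply: is_cvg_nneseries => k _ _; exact: measure_ge0.
apply: nearW => n; rewrite big_mkord.
apply: (@le_trans _ _ (\sum_(k < n) `|G (st k).2 - G (st k).1|)%:E).
  rewrite -sumEFin; apply: lee_sum => k _.
  have [le12 IE] := stP k; rewrite -/(I k) IE.
  (* The half-open interval is introduced because its Stieltjes measure is exactly the increment of
     [G]. *)
  apply: (@le_trans _ _ (lebesgue_stieltjes_measure G `](st k).1, (st k).2]%classic)).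
    by apply: le_measure; rewrite ?inE; [exact: measurable_itv..|exact: subset_itvW].
  by rewrite lebesgue_stieltjes_itv_oc// lee_fin ler_norm.
rewrite lee_fin ltW//.
apply: (H 'I_n (fun k => (st k).1) (fun k => (st k).2)).
- by move=> k; exact: (stP k).1.
- move=> i j _ _ /=; rewrite -(stP i).2 -(stP j).2 => ij.
  by apply/val_inj; exact: tI ij.
(* The lengths add up to the measure of a finite disjoint union contained in [U]. *)
- rewrite -lte_fin -sumEFin; apply: le_lt_trans Ud.
  rewrite (eq_bigr (fun k : 'I_n => mu (I k))); last first.
    move=> k _; have [le12 ->] := stP k; rewrite lebesgue_measure_itv/= lte_fin.
    by case: ltgtP le12 => // -> _; rewrite subrr.
  have mIn : measurable (\big[setU/set0]_(k < n) I k : set (measurableTypeR R)).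
    by apply: bigsetU_measurable => k _; exact: mI.
  rewrite -(@measure_semi_additive_ord_I _ _ _ mu I)//.
  - apply: le_measure; rewrite ?inE; [exact: mIn|exact: mU|].
    by rewrite -bigcup_mkord; apply: bigcup_sub => k _; exact: IU.
  - by move=> k _; exact: mI.
  - exact: sub_trivIset tI.
Qed.

Lemma nondecreasing_abs_contR_density a b G : a <= b ->
  nondecreasing G -> abs_contR G ->
  exists g : R -> R, mu.-integrable setT (EFin \o g) /\
    forall x, a <= x <= b -> G x - G a = \int[mu]_(t in `]a, x]) g t.
Proof.
move=> ab ndG acG.
have rcG : right_continuous G.
  by apply: right_continuousW; exact: abs_contR_continuous.
pose mG := isCumulative.Build R _ R G ndG rcG.
pose G' : cumulative R R := HB.pack G mG.
have mD : measurable (`]a, b]%classic : set (measurableTypeR R)).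
  exact: measurable_itv.
have fD : (lebesgue_stieltjes_measure G' `]a, b]%classic < +oo)%E.
  by rewrite lebesgue_stieltjes_itv_oc// ltry.
(* Restriction to []a, b]] makes the Stieltjes measure finite before Radon-Nikodym is applied. *)
pose nu : {finite_measure set (measurableTypeR R) -> \bar R} := mfrestr mD fD.
have dom : nu `<< mu.
  apply/null_content_dominatesP => A mA A0.
  rewrite /nu/= /mfrestr/= /mrestr.
  apply: (@abs_contR_stieltjes_dominated G' acG); first exact: measurableI.
  by apply: (subset_measure0 _ _ _ A0) => //; exact: measurableI.
have [g [g0 gfin ig gE]] := radon_nikodym_sigma_finite dom.
have EFg : EFin \o (fine \o g) = g by apply/funext => x /=; rewrite fineK.
exists (fine \o g); rewrite EFg; split => // x /andP[ax xb].
rewrite /Rintegral.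
under eq_integral do rewrite fineK//.
rewrite -gE//= /mfrestr/= /mrestr/= setIidl; last first.
  by apply: subset_itvl; rewrite bnd_simp.
by rewrite lebesgue_stieltjes_itv_oc.
Qed.

End stieltjes_density.

(** * The fundamental theorem for absolutely continuous functions *)

Section absolutely_continuous_FTC.
Context {R : realType}.
Implicit Types (a b x y : R) (f : R -> R).
Local Notation mu := (@lebesgue_measure R).

Lemma abs_cont_density a b f : a <= b -> abs_cont a b f ->
  exists2 g : R -> R, mu.-integrable setT (EFin \o g) &
    forall x, a <= x <= b -> f x - f a = \int[mu]_(t in `]a, x]) g t.
Proof.
move=> ab acf.
have [V [N [ndV ndN acV acN fVN]]] := abs_cont_decomposition ab acf.
have [v [iv vE]] := nondecreasing_abs_contR_density ab ndV acV.
have [n [i_n nE]] := nondecreasing_abs_contR_density ab ndN acN.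
exists (v \- n).
  have -> : EFin \o (v \- n) = ((EFin \o v) \- (EFin \o n))%E by apply/funext.
  exact: integrableB.
move=> x xab; rewrite !fVN ?lexx ?ab//.
have -> : V x - N x - (V a - N a) = (V x - V a) - (N x - N a) by ring.
rewrite vE// nE// -RintegralB//.
- exact: integrableS iv.
- exact: integrableS i_n.
Qed.

(** Lebesgue differentiation gives the derivative of the integral of the density almost everywhere,
    and this integral differs from [f] by a constant near each point of []a, b[]. *)
Lemma abs_cont_FTC a b f : a <= b -> abs_cont a b f ->
  exists g : R -> R, [/\ mu.-integrable setT (EFin \o g),
    forall x, a <= x <= b -> f x - f a = \int[mu]_(t in `]a, x]) g t
    & {ae mu, forall x, a < x < b -> derive1 f x = g x}].
Proof.
move=> ab acf; have [g ig fE] := abs_cont_density ab acf.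
exists g; split => //.
have locg : locally_integrable setT g.
  by apply: open_integrable_locally => //; exact: openT.
have := @FTC1 R g (BRight a) _ locg.
have iy y : mu.-integrable [set` Interval (BRight a) (BRight y)] (EFin \o g).
  exact: integrableS ig.
move=> /(_ iy) /=; apply: filterS; first exact: (ae_filter_ringOfSetsType mu).
move=> x + /andP[ax xb].
move=> /(_ ax) [dF F'].
rewrite derive1E -F' derive1E.
set F := fun y : R => _ in dF *.
have fF : \near x, f x = (F \+ cst (f a)) x.
  have : x \in `]a, b[ by rewrite in_itv/= ax.
  move=> /near_in_itvoo; apply: filterS => y; rewrite in_itv/= => /andP[ay yb].
  by rewrite /= /F -fE ?subrK// !ltW.
rewrite (near_eq_derive _ fF) deriveD//.
by rewrite derive_cst addr0.
Qed.

End absolutely_continuous_FTC.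

(** * Fubini on a triangle *)

Section kernel_Fubini.
Context {R : realType}.
Local Notation mu := (@lebesgue_measure R).

Local Notation T := (measurableTypeR R).

(** The bounds on [q] and on the integral of [k] in [s] make the double integral of
    [|p t * q s * k (t, s)|] at most [M * C] times the integral of [|p|], so Fubini applies. The
    last hypothesis makes the inner integral finite at every [s], where Fubini alone gives almost
    every [s]; real factors can then be pulled out. *)
Lemma Fubini_kernel (D : set T) (p q : T -> R) (k : T * T -> R) (M C : R) :
  measurable D -> mu.-integrable D (EFin \o p) -> measurable_fun D q ->
  (forall s, D s -> `|q s| <= M) ->
  measurable_fun setT k -> (forall z, 0 <= k z) ->
  (forall t, D t -> (\int[mu]_(s in D) (k (t, s))%:E <= C%:E)%E) ->
  (forall s, D s -> mu.-integrable D (fun t => (p t * k (t, s))%:E)) ->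
  \int[mu]_(t in D) (p t * \int[mu]_(s in D) (q s * k (t, s))) =
  \int[mu]_(s in D) (q s * \int[mu]_(t in D) (p t * k (t, s))).
Proof.
move=> mD ip mq qM mk k0 kC ipk.
(* Extension by zero outside [D] in both variables lets Fubini be used on the whole plane. *)
pose F (z : T * T) := (p \_ D) z.1 * (q \_ D) z.2 * k z.
have mp : measurable_fun D p.
  by apply/measurable_EFinP; case/integrableP : ip.
have mpD : measurable_fun setT (p \_ D) by apply/(measurable_restrictT _ _).1.
have mqD : measurable_fun setT (q \_ D) by apply/(measurable_restrictT _ _).1.
have mF : measurable_fun setT F.
  apply: measurable_funM => //; apply: measurable_funM.
  - exact: (measurableT_comp mpD measurable_fst).
  - exact: (measurableT_comp mqD measurable_snd).
have mks t : measurable_fun setT (fun s => k (t, s)).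
  exact: measurableT_comp (pair1_measurable t).
have ik t : D t -> mu.-integrable D (fun s => (k (t, s))%:E).
  move=> Dt; apply/integrableP; split.
    by apply/measurable_EFinP; exact: (measurable_funTS (mks t)).
  under eq_integral do rewrite /= ger0_norm//.
  by apply: le_lt_trans (kC _ Dt) _; exact: ltry.
have M0 s : D s -> 0 <= M by move=> /qM; exact: le_trans.
have qkM t s : D s -> `|q s * k (t, s)| <= M * k (t, s).
  by move=> Ds; rewrite normrM (ger0_norm (k0 _)) ler_wpM2r// qM.
have iqk t : D t -> mu.-integrable D (fun s => (q s * k (t, s))%:E).
  move=> Dt; apply: (@le_integrable _ _ _ mu D mD _ (fun s => (M * k (t, s))%:E)).
  - by apply/measurable_EFinP; apply: measurable_funM => //; exact: (measurable_funTS (mks t)).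
  - move=> s Ds /=; rewrite lee_fin (le_trans (qkM t s Ds))//.
    by rewrite ger0_norm ?mulr_ge0 ?(M0 _ Ds).
  - by under eq_fun do rewrite EFinM; exact: (integrableZl mD M (ik t Dt)).
have DE (h : T -> R) s : (h \_ D) s = if s \in D then h s else 0.
  by rewrite patchE.
have FE (t s : T) : F (t, s) =
    ((fun s : T => (p \_ D) t * (q s * k (t, s))) \_ D) s.
  by rewrite /F/= [RHS]DE (DE q); case: ifP => _; ring.
have FE' (t s : T) : F (t, s) =
    ((fun t : T => (q \_ D) s * (p t * k (t, s))) \_ D) t.
  by rewrite /F/= [RHS]DE (DE p); case: ifP => _; ring.
(* [M] and [C] need be nonnegative only if [D] has a point, hence the absolute value. *)
have iKp : mu.-integrable setT (fun t => (`|M * C|%:E * `|(p \_ D) t|%:E)%E).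
  apply: integrableZl => //; apply: integrable_norm => /=.
  by rewrite -restrict_EFin; apply/integrable_restrict => //; rewrite setTI.
have Fin : (mu \x mu)%E.-integrable setT (EFin \o F).
  apply/integrable12ltyP; first exact/measurable_EFinP.
  apply: (@le_lt_trans _ _ (\int[mu]_t (`|M * C|%:E * `|(p \_ D) t|%:E))%E).
    apply: ge0_le_integral => //.
    - by move=> t _; apply: integral_ge0.
    - apply: (measurable_fun_fubini_tonelli_F (abse \o (EFin \o F))) => //=.
      by apply: measurableT_comp => //; exact/measurable_EFinP.
    - by have /integrableP[] := iKp.
    move=> t _ /=; have [Dt|nDt] := pselect (D t); last first.
      rewrite (_ : (fun s => _) = cst 0%E) ?integral0 ?mule_ge0 ?lee_fin//.
      by apply/funext => s; rewrite /F/= DE memNset// !mul0r normr0.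
    have -> : (\int[mu]_s `|F (t, s)|%:E =
        \int[mu]_(s in D) `|p t * (q s * k (t, s))|%:E)%E.
      rewrite [RHS]integral_mkcond; apply: eq_integral => s _.
      rewrite FE DE (DE p) (mem_set Dt) patchE; case: ifP => //.
      by rewrite normr0.
    apply: (@le_trans _ _ (\int[mu]_(s in D) ((`|p t| * M)%:E * (k (t, s))%:E))%E).
      apply: ge0_le_integral => //.
      - apply/measurable_EFinP; apply: measurableT_comp => //.
        apply: measurable_funM => //; apply: measurable_funM => //.
        exact: (measurable_funTS (mks t)).
      - under eq_fun do rewrite -EFinM.
        apply/measurable_EFinP; apply: measurable_funM => //.
        exact: (measurable_funTS (mks t)).
      - by move=> s Ds /=; rewrite lee_fin normrM -mulrA ler_wpM2l// qkM.
    have pM0 : 0 <= `|p t| * M by rewrite mulr_ge0// (M0 _ Dt).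
    rewrite ge0_integralZl//; last 2 first.
    - by apply/measurable_EFinP; exact: (measurable_funTS (mks t)).
    - by move=> s _; rewrite lee_fin.
    apply: (@le_trans _ _ ((`|p t| * M)%:E * C%:E)%E).
      by rewrite lee_wpmul2l ?lee_fin// kC.
    rewrite -!EFinM lee_fin DE (mem_set Dt) -mulrA mulrC ler_wpM2r//.
    exact: ler_norm.
  have /integrableP[_] := iKp; under eq_integral.
    by move=> t _; rewrite gee0_abs ?mule_ge0 ?lee_fin//; over.
  by [].
have EL t : (\int[mu]_s (EFin \o F) (t, s) =
    ((p \_ D) t * \int[mu]_(s in D) (q s * k (t, s)))%:E)%E.
  transitivity (\int[mu]_(s in D) (((p \_ D) t)%:E * (q s * k (t, s))%:E))%E.
    rewrite [RHS]integral_mkcond; apply: eq_integral => s _.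
    by rewrite /= FE !patchE; case: ifP.
  have [Dt|nDt] := pselect (D t).
    rewrite integralZl//; last exact: iqk.
    by rewrite EFinM /Rintegral fineK//; exact/integrable_fin_num/iqk.
  rewrite patchE memNset// mul0r.
  by under eq_integral do rewrite mul0e; rewrite integral0.
have ER s : (\int[mu]_t (EFin \o F) (t, s) =
    ((q \_ D) s * \int[mu]_(t in D) (p t * k (t, s)))%:E)%E.
  transitivity (\int[mu]_(t in D) (((q \_ D) s)%:E * (p t * k (t, s))%:E))%E.
    rewrite [RHS]integral_mkcond; apply: eq_integral => t _.
    by rewrite /= FE' !patchE; case: ifP.
  have [Ds|nDs] := pselect (D s).
    rewrite integralZl//; last exact: ipk.
    by rewrite EFinM /Rintegral fineK//; exact/integrable_fin_num/ipk.
  rewrite patchE memNset// mul0r.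
  by under eq_integral do rewrite mul0e; rewrite integral0.
rewrite Rintegral_mkcond [RHS]Rintegral_mkcond; congr fine.
transitivity (\int[mu]_t \int[mu]_s (EFin \o F) (t, s))%E.
  apply: eq_integral => t _; rewrite EL !DE.
  by case: ifP => _ //; rewrite mul0r.
rewrite (Fubini Fin); apply: eq_integral => s _; rewrite ER !DE.
by case: ifP => _ //; rewrite mul0r.
Qed.

End kernel_Fubini.

(** * Continuous functions on a segment *)

Section segment_facts.
Context {R : realType}.
Implicit Types (a b x t : R) (f : R -> R).
Local Notation mu := (@lebesgue_measure R).
Local Notation T := (measurableTypeR R).

Lemma continuous_segment_bounded a b f : {within `[a, b], continuous f} ->
  exists2 M : R, 0 <= M & forall x, a <= x <= b -> `|f x| <= M.
Proof.
move=> cf; have /compact_bounded[M0 [_ Mf]] :=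
  continuous_compact cf (@segment_compact R a b).
exists `|M0 + 1| => // x xab.
have M01 : M0 < M0 + 1 by rewrite ltrDl.
apply: le_trans (Mf _ M01 (f x) _) (ler_norm _).
by exists x => //=; rewrite in_itv/=.
Qed.

Lemma continuous_segment_measurable a b f : {within `[a, b], continuous f} ->
  measurable_fun (`]a, b[%classic : set T) f.
Proof.
move=> cf; have : measurable_fun (`[a, b]%classic : set R) f.
  by apply: subspace_continuous_measurable_fun.
by apply: measurable_funS => //; exact: subset_itv_oo_cc.
Qed.

Lemma integrable_mulr_bounded (D : set T) (p q : T -> R) (M : R) :
  measurable D -> mu.-integrable D (EFin \o p) -> measurable_fun D q ->
  (forall x, D x -> `|q x| <= M) ->
  mu.-integrable D (fun x => (p x * q x)%:E).
Proof.
move=> mD ip mq qM.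
have mp : measurable_fun D p by apply/measurable_EFinP; case/integrableP : ip.
apply: (@le_integrable _ _ _ mu D mD _ (fun x => (M%:E * (p x)%:E)%E)).
- by apply/measurable_EFinP; exact: measurable_funM.
- move=> x Dx; rewrite -EFinM /= lee_fin !normrM mulrC ler_wpM2r//.
  exact: le_trans (qM _ Dx) (ler_norm _).
- exact: (integrableZl mD M ip).
Qed.

Lemma continuous_segment_integrable a b f : {within `[a, b], continuous f} ->
  mu.-integrable (`]a, b[%classic : set T) (EFin \o f).
Proof.
move=> cf; have icc : mu.-integrable (`[a, b]%classic : set T) (EFin \o f).
  by apply: continuous_compact_integrable => //; exact: segment_compact.
by apply: integrableS icc => //; exact: subset_itv_oo_cc.
Qed.

End segment_facts.

(** * The fundamental theorem for derivatives relative to a segment *)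

Section derive_in_FTC.
Context {R : realType}.
Implicit Types (a b x t : R) (f : R -> R).
Local Notation mu := (@lebesgue_measure R).

(** Solve the difference quotient for [f z]: a convergent quotient times [z - x] tends to zero. *)
Lemma derivable_in_continuous a b f :
  (forall x, x \in `[a, b] -> derivable_in `[a, b] f x) ->
  {within `[a, b], continuous f}.
Proof.
move=> df; apply/subspace_continuousP => x /= xab.
have /cvg_ex[/= l fl] := df x xab.
have fx : f x + diff_quot f x z * (z - x) @[z --> within `[a, b] x^'] --> f x + l * 0.
  apply: cvgD; first exact: cvg_cst.
  apply: cvgM => //; rewrite -[X in _ --> X](subrr x).
  apply: cvgB; last exact: cvg_cst.
  by apply: cvg_within_filter; apply: cvg_within_filter; exact: cvg_id.
rewrite mulr0 addr0 in fx.
move=> A /[dup] /nbhs_singleton Ax /fx; rewrite /= !near_simpl !near_withinE.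
apply: filterS => z zA zab; have [->//|zx] := eqVneq z x.
by have := zA zx zab; rewrite /diff_quot divfK ?subr_eq0// addrC subrK.
Qed.

(** Near an interior point the restriction to [[a, b]] is void, and the difference quotient
    completed by its limit is the slope function of Caratheodory's criterion. *)
Lemma derivable_in_interior a b f x : a < x < b -> derivable_in `[a, b] f x ->
  is_derive x 1 f (derive_in `[a, b] f x).
Proof.
move=> xab df.
have fl : diff_quot f x z @[z --> x^'] --> derive_in `[a, b] f x.
  have xi : x \in `]a, b[ by rewrite in_itv/=.
  move=> A /df; rewrite /= !near_simpl !near_withinE.
  apply: filterS2 (near_in_itvoo xi) => z zi zA zx; apply: zA => //=.
  exact: subset_itv_oo_cc zi.
apply/is_derive1_caratheodory.
exists (fun z => if z == x then derive_in `[a, b] f x else diff_quot f x z).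
split; last by rewrite eqxx.
- move=> z; case: eqVneq => [->|zx]; first by rewrite !subrr mulr0.
  by rewrite /diff_quot divfK// subr_eq0.
- apply/continuous_withinNx; rewrite eqxx.
  apply: cvg_trans fl; apply: near_eq_cvg; near=> z.
  rewrite ifF//; apply/negbTE; near: z.
  exact: nbhs_dnbhs_neq.
Unshelve. all: by end_near. Qed.

(** Inside [[t, b]] the relative derivative is the ordinary one; at the endpoints the fundamental
    theorem asks only for continuity of [f]. *)
Lemma derive_in_FTC a b f t : t \in `[a, b] ->
  (forall x, x \in `[a, b] -> derivable_in `[a, b] f x) ->
  {within `[a, b], continuous (derive_in `[a, b] f)} ->
  f b - f t = \int[mu]_(s in `]t, b[) derive_in `[a, b] f s.
Proof.
rewrite in_itv/= => /andP[at_ tb] df cf'.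
have cf := derivable_in_continuous df.
move: tb; rewrite le_eqVlt => /predU1P[->|tb].
  by rewrite subrr set_itv_ge ?bnd_simp// Rintegral_set0.
have sub : `[t, b] `<=` `[a, b] by apply: subset_itvr; rewrite bnd_simp.
have cft' := continuous_subspaceW sub cf'.
have cft := continuous_subspaceW sub cf.
have [c1 c2 c3] := (continuous_within_itvP _ tb).1 cft.
have is_d x : x \in `]t, b[ -> is_derive x 1 f (derive_in `[a, b] f x).
  rewrite in_itv/= => /andP[tx xb]; apply: derivable_in_interior.
    by rewrite xb (le_lt_trans at_ tx).
  by apply: df; rewrite in_itv/= (le_trans at_ (ltW tx)) ltW.
have F2 : derivable_oo_LRcontinuous f t b by split => // x /is_d[].
have F3 : {in `]t, b[, derive1 f =1 derive_in `[a, b] f}.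
  by move=> x /is_d[_ <-]; rewrite derive1E.
have := continuous_FTC2 tb cft' F2 F3.
rewrite integral_itv_bndoo => [FTC|]; first by rewrite /Rintegral FTC.
by apply/measurable_EFinP; exact: continuous_segment_measurable.
Qed.

End derive_in_FTC.

Section triangle_Fubini.
Context {R : realType}.
Implicit Types (a b : R).
Local Notation mu := (@lebesgue_measure R).
Local Notation T := (measurableTypeR R).

(** The indicator of [E] is absorbed into the kernel, which stays nonnegative and below [k], so [M]
    and [C] still serve. *)
Lemma Fubini_section (D : set T) (E : set (T * T)) (p q : T -> R)
    (k : T * T -> R) (M C : R) :
  measurable D -> measurable E ->
  mu.-integrable D (EFin \o p) -> measurable_fun D q ->
  (forall s, D s -> `|q s| <= M) ->
  measurable_fun setT k -> (forall z, 0 <= k z) ->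
  (forall t, D t -> (\int[mu]_(s in D) (k (t, s))%:E <= C%:E)%E) ->
  (forall s, D s ->
    mu.-integrable (D `&` [set t | E (t, s)]) (fun t => (p t * k (t, s))%:E)) ->
  \int[mu]_(t in D) (p t * \int[mu]_(s in D `&` [set s | E (t, s)]) (q s * k (t, s))) =
  \int[mu]_(s in D) (q s * \int[mu]_(t in D `&` [set t | E (t, s)]) (p t * k (t, s))).
Proof.
move=> mD mE ip mq qM mk k0 kC ipk.
have mE1 s : measurable ([set t | E (t, s)] : set T).
  have -> : [set t | E (t, s)] = ysection E s by rewrite ysectionE.
  exact: measurable_ysection.
pose kE z := k z * \1_E z.
have kE_ge0 z : 0 <= kE z by rewrite mulr_ge0// indicE.
have secl t : \int[mu]_(s in D `&` [set s | E (t, s)]) (q s * k (t, s)) =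
    \int[mu]_(s in D) (q s * kE (t, s)).
  rewrite Rintegral_mkcondr; apply: eq_Rintegral => s _.
  rewrite patchE /kE indicE mulrA.
  have -> : (s \in [set s | E (t, s)]) = ((t, s) \in E) by apply/idP/idP; rewrite !inE.
  by case: (_ \in _); rewrite ?mulr1 ?mulr0.
have secr s : \int[mu]_(t in D `&` [set t | E (t, s)]) (p t * k (t, s)) =
    \int[mu]_(t in D) (p t * kE (t, s)).
  rewrite Rintegral_mkcondr; apply: eq_Rintegral => t _.
  rewrite patchE /kE indicE mulrA.
  have -> : (t \in [set t | E (t, s)]) = ((t, s) \in E) by apply/idP/idP; rewrite !inE.
  by case: (_ \in _); rewrite ?mulr1 ?mulr0.
under eq_Rintegral do rewrite secl.
under [in RHS]eq_Rintegral do rewrite secr.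
apply: (@Fubini_kernel _ D p q kE M C) => //.
- exact: measurable_funM.
- move=> t Dt; apply: le_trans (kC _ Dt); apply: ge0_le_integral => //.
  + by move=> s _; rewrite lee_fin.
  + apply/measurable_EFinP/measurable_funTS.
    exact: (measurableT_comp (measurable_funM mk _) (pair1_measurable t)).
  + apply/measurable_EFinP/measurable_funTS.
    exact: (measurableT_comp mk (pair1_measurable t)).
  + move=> s _; rewrite lee_fin /kE indicE ler_piMr//.
    by case: (_ \in _).
- move=> s Ds; have /(integrable_restrict mu (mE1 s) mD) := ipk _ Ds.
  apply: eq_integrable => // t _; rewrite patchE /kE indicE mulrA.
  have -> : (t \in [set t | E (t, s)]) = ((t, s) \in E) by apply/idP/idP; rewrite !inE.
  by case: (_ \in _); rewrite ?mulr1 ?mulr0.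
Qed.

Lemma measurable_lt_diag : measurable [set z : T * T | (z.1 : R) < z.2].
Proof.
have := @measurable_fun_ltr _ (T * T)%type R setT fst snd measurable_fst measurable_snd.
by move=> /(_ measurableT [set true]); rewrite setTI; exact.
Qed.

(** The sections of the half-plane [t < s] within []a, b[] are []t, b[] and []a, s[]. This order
    serves ordinary integration by parts and the left Caputo derivative; the reversed one serves the
    right Caputo derivative. *)
Lemma Fubini_triangle_lt a b (p q : T -> R) (k : T * T -> R) (M C : R) :
  mu.-integrable `]a, b[ (EFin \o p) -> measurable_fun (`]a, b[%classic : set T) q ->
  (forall s, `]a, b[%classic s -> `|q s| <= M) ->
  measurable_fun setT k -> (forall z, 0 <= k z) ->
  (forall t, `]a, b[%classic t -> (\int[mu]_(s in `]a, b[) (k (t, s))%:E <= C%:E)%E) ->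
  (forall s, `]a, b[%classic s ->
    mu.-integrable `]a, s[ (fun t => (p t * k (t, s))%:E)) ->
  \int[mu]_(t in `]a, b[) (p t * \int[mu]_(s in `]t, b[) (q s * k (t, s))) =
  \int[mu]_(s in `]a, b[) (q s * \int[mu]_(t in `]a, s[) (p t * k (t, s))).
Proof.
move=> ip mq qM mk k0 kC ipk.
have El t : t \in (`]a, b[%classic : set T) ->
    `]a, b[%classic `&` [set s | t < s] = `]t, b[%classic.
  rewrite inE/= in_itv/= => /andP[at_ tb]; apply/seteqP; split => s /=; rewrite !in_itv/=.
    by move=> [/andP[_ ->] ->].
  by move=> /andP[ts ->]; rewrite ts (lt_trans at_ ts).
have Er s : s \in (`]a, b[%classic : set T) ->
    `]a, b[%classic `&` [set t | t < s] = `]a, s[%classic.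
  rewrite inE/= in_itv/= => /andP[as_ sb]; apply/seteqP; split => t /=; rewrite !in_itv/=.
    by move=> [/andP[-> _] ->].
  by move=> /andP[-> ts]; rewrite ts (lt_trans ts sb).
have mD : measurable (`]a, b[%classic : set T) by exact: measurable_itv.
transitivity (\int[mu]_(t in `]a, b[)
    (p t * \int[mu]_(s in `]a, b[%classic `&` [set s | t < s]) (q s * k (t, s)))).
  by apply: eq_Rintegral => t tab; rewrite El.
rewrite (Fubini_section mD measurable_lt_diag ip mq qM mk k0 kC) /=.
  by apply: eq_Rintegral => s sab; rewrite Er.
by move=> s sab; rewrite Er ?inE//; exact: ipk.
Qed.

Lemma Fubini_triangle_gt a b (p q : T -> R) (k : T * T -> R) (M C : R) :
  mu.-integrable `]a, b[ (EFin \o p) -> measurable_fun (`]a, b[%classic : set T) q ->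
  (forall s, `]a, b[%classic s -> `|q s| <= M) ->
  measurable_fun setT k -> (forall z, 0 <= k z) ->
  (forall t, `]a, b[%classic t -> (\int[mu]_(s in `]a, b[) (k (t, s))%:E <= C%:E)%E) ->
  (forall s, `]a, b[%classic s ->
    mu.-integrable `]s, b[ (fun t => (p t * k (t, s))%:E)) ->
  \int[mu]_(t in `]a, b[) (p t * \int[mu]_(s in `]a, t[) (q s * k (t, s))) =
  \int[mu]_(s in `]a, b[) (q s * \int[mu]_(t in `]s, b[) (p t * k (t, s))).
Proof.
move=> ip mq qM mk k0 kC ipk.
have El t : t \in (`]a, b[%classic : set T) ->
    `]a, b[%classic `&` [set s | s < t] = `]a, t[%classic.
  rewrite inE/= in_itv/= => /andP[at_ tb]; apply/seteqP; split => s /=; rewrite !in_itv/=.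
    by move=> [/andP[-> _] ->].
  by move=> /andP[-> st]; rewrite st (lt_trans st tb).
have Er s : s \in (`]a, b[%classic : set T) ->
    `]a, b[%classic `&` [set t | s < t] = `]s, b[%classic.
  rewrite inE/= in_itv/= => /andP[as_ sb]; apply/seteqP; split => t /=; rewrite !in_itv/=.
    by move=> [/andP[_ ->] ->].
  by move=> /andP[st ->]; rewrite st (lt_trans as_ st).
have mD : measurable (`]a, b[%classic : set T) by exact: measurable_itv.
have mE : measurable [set z : T * T | (z.2 : R) < z.1].
  have := @measurable_fun_ltr _ (T * T)%type R setT snd fst measurable_snd measurable_fst.
  by move=> /(_ measurableT [set true]); rewrite setTI; exact.
transitivity (\int[mu]_(t in `]a, b[)
    (p t * \int[mu]_(s in `]a, b[%classic `&` [set s | s < t]) (q s * k (t, s)))).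
  by apply: eq_Rintegral => t tab; rewrite El.
rewrite (Fubini_section mD mE ip mq qM mk k0 kC) /=.
  by apply: eq_Rintegral => s sab; rewrite Er.
by move=> s sab; rewrite Er ?inE//; exact: ipk.
Qed.

End triangle_Fubini.

(** * Integration by parts *)

Section absolutely_continuous_by_parts.
Context {R : realType}.
Implicit Types (a b x y : R) (f phi : R -> R).
Local Notation mu := (@lebesgue_measure R).
Local Notation T := (measurableTypeR R).

Lemma abs_cont_continuous a b f : a <= b -> abs_cont a b f ->
  {within `[a, b], continuous f}.
Proof.
move=> ab acf; apply: (@subspace_eq_continuous _ _ _ (f \o clamp a b)).
  by move=> x; rewrite inE/= in_itv/= => xab; rewrite clamp_id.
by apply: continuous_subspaceT; apply: abs_contR_continuous; exact: abs_contR_clamp.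
Qed.

(** The density of [f] agrees with [derive1 f] almost everywhere, and dropping the endpoint [x] does
    not change the integral. *)
Lemma abs_cont_integral_derive1 a b f x : abs_cont a b f ->
  mu.-integrable (`]a, b[%classic : set T) (EFin \o derive1 f) ->
  a <= x <= b ->
  f x - f a = \int[mu]_(t in `]a, x[) derive1 f t.
Proof.
move=> acf if' /andP[ax xb]; have ab := le_trans ax xb.
have [g [ig fE aeg]] := abs_cont_FTC ab acf.
rewrite fE ?ax// -Rintegral_itv_bndo_bndc; last exact: integrableS ig.
rewrite /Rintegral; congr fine; apply: ae_eq_integral => //.
- by have /integrableP[/measurable_funTS] := ig; exact.
- have /integrableP[mf' _] := if'.
  by apply: measurable_funS mf' => //; apply: subset_itvl; rewrite bnd_simp.
- apply: filterS aeg; first exact: (ae_filter_ringOfSetsType mu).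
  move=> t gt /=; rewrite in_itv/= => /andP[at_ tx].
  by rewrite gt// at_ (lt_le_trans tx).
Qed.

(** With [phi b - phi t] and [f t - f a] written as integrals of the derivatives, both sides come
    from integrating the product of [derive1 f t] and the derivative of [phi] at [s] over the
    triangle [t < s], in the two orders. *)
Lemma abs_cont_by_parts a b f phi : a < b -> abs_cont a b f ->
  mu.-integrable (`]a, b[%classic : set T) (EFin \o derive1 f) ->
  (forall x, x \in `[a, b] -> derivable_in `[a, b] phi x) ->
  {within `[a, b], continuous (derive_in `[a, b] phi)} ->
  \int[mu]_(t in `]a, b[) (derive1 f t * phi t) =
  f b * phi b - f a * phi a - \int[mu]_(t in `]a, b[) (f t * derive_in `[a, b] phi t).
Proof.
(* Here [u], [v] are [f b], [f a]; [p], [q] are [phi b], [phi a]; [i] is the integral of [derive1 f]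
   times [phi], and [j] that of [f] times the derivative of [phi]. *)
have alg (u v p q i j : R) : (u - v) * p - i = j - (p - q) * v -> i = u * p - v * q - j by lra.
move=> ab acf if' dphi cphi'; set psi := derive_in _ phi in cphi' *.
have le_ab := ltW ab.
have phiE t : a <= t <= b -> phi b - phi t = \int[mu]_(s in `]t, b[) psi s.
  by move=> tab; apply: derive_in_FTC => //; rewrite in_itv.
have fE t : a <= t <= b -> f t - f a = \int[mu]_(s in `]a, t[) derive1 f s.
  exact: abs_cont_integral_derive1.
have cphi := derivable_in_continuous dphi.
have [M M0 psiM] := continuous_segment_bounded cphi'.
have [Mp Mp0 phiM] := continuous_segment_bounded cphi.
have mpsi := continuous_segment_measurable cphi'.
have mphi := continuous_segment_measurable cphi.
have cf := abs_cont_continuous le_ab acf.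
have ipsi := continuous_segment_integrable cphi'.
have mD : measurable (`]a, b[%classic : set T) by exact: measurable_itv.
have if'phi : mu.-integrable (`]a, b[%classic : set T) (fun t => (derive1 f t * phi t)%:E).
  apply: (integrable_mulr_bounded mD if' mphi (M := Mp)) => t /=.
  by rewrite in_itv/= => /andP[at_ tb]; rewrite phiM// !ltW.
have ifpsi : mu.-integrable (`]a, b[%classic : set T) (fun t => (f t * psi t)%:E).
  have icf := continuous_segment_integrable cf.
  apply: (integrable_mulr_bounded mD icf mpsi (M := M)) => t /=.
  by rewrite in_itv/= => /andP[at_ tb]; rewrite psiM// !ltW.
have psiM' s : `]a, b[%classic s -> `|psi s| <= M.
  by rewrite /= in_itv/= => /andP[as_ sb]; rewrite psiM// !ltW.
have k1 t : `]a, b[%classic t -> (\int[mu]_(s in `]a, b[) (1%:E) <= (b - a)%:E)%E.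
  move=> _; rewrite integral_cst// mul1e [leLHS](lebesgue_measure_itv `]a, b[)/=.
  by rewrite lte_fin ab -EFinB.
have k2 s : `]a, b[%classic s ->
    mu.-integrable `]a, s[ (fun t => (derive1 f t * 1)%:E).
  rewrite /= in_itv/= => /andP[as_ sb].
  have ias : mu.-integrable (`]a, s[%classic : set T) (EFin \o derive1 f).
    by apply: integrableS if' => //; apply: subset_itvl; rewrite bnd_simp ltW.
  by apply: eq_integrable ias => // t _; rewrite mulr1.
have Fub := Fubini_triangle_lt (k := fun=> 1) if' mpsi psiM' (measurable_cst _)
  (fun=> ler01) k1 k2.
have if'c : mu.-integrable (`]a, b[%classic : set T) (fun t => (derive1 f t * phi b)%:E).
  by apply: eq_integrable (integrableZr mD (phi b) if').
have ipsic : mu.-integrable (`]a, b[%classic : set T) (fun t => (psi t * f a)%:E).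
  by apply: eq_integrable (integrableZr mD (f a) ipsi).
have fEb : f b - f a = \int[mu]_(s in `]a, b[) derive1 f s by apply: fE; rewrite lexx le_ab.
have phiEa : phi b - phi a = \int[mu]_(s in `]a, b[) psi s by apply: phiE; rewrite lexx le_ab.
have lhsE : \int[mu]_(t in `]a, b[) (derive1 f t * \int[mu]_(s in `]t, b[) (psi s * 1)) =
    (f b - f a) * phi b - \int[mu]_(t in `]a, b[) (derive1 f t * phi t).
  apply: etrans (etrans (RintegralB mD if'c if'phi)
    (congr1 (+%R^~ _) (etrans (RintegralZr _ mD if') (congr1 ( *%R^~ _) (esym fEb))))).
  apply: eq_Rintegral => t; rewrite inE/= in_itv/= => /andP[at_ tb].
  under eq_Rintegral do rewrite mulr1.
  have tab : a <= t <= b by rewrite !ltW.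
  by rewrite -(phiE t tab) mulrBr.
have rhsE : \int[mu]_(s in `]a, b[) (psi s * \int[mu]_(t in `]a, s[) (derive1 f t * 1)) =
    \int[mu]_(t in `]a, b[) (f t * psi t) - (phi b - phi a) * f a.
  apply: etrans (etrans (RintegralB mD ifpsi ipsic)
    (congr1 (fun z => _ - z) (etrans (RintegralZr _ mD ipsi) (congr1 ( *%R^~ _) (esym phiEa))))).
  apply: eq_Rintegral => t; rewrite inE/= in_itv/= => /andP[at_ tb].
  under eq_Rintegral do rewrite mulr1.
  have tab : a <= t <= b by rewrite !ltW.
  by rewrite -(fE t tab) mulrBr (mulrC (f t)).
exact: alg (etrans (esym lhsE) (etrans Fub rhsE)).
Qed.

End absolutely_continuous_by_parts.

(** * Fractional integration by parts *)

Section weakly_singular_kernel.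
Context {R : realType}.
Implicit Types (a b g t u v x y : R).
Local Notation mu := (@lebesgue_measure R).
Local Notation T := (measurableTypeR R).

(** Monotone convergence along segments exhausting []x, y[]; since they avoid the endpoints, the
    fundamental theorem can be used on them even for a function singular at [x] or [y]. *)
Lemma ge0_integral_oo_le (h : T -> R) x y (c : R) :
  (forall s, 0 <= h s) -> measurable_fun setT h -> 0 <= c ->
  (forall u v, x < u -> u < v -> v < y ->
    (\int[mu]_(s in `[u, v]) (h s)%:E <= c%:E)%E) ->
  (\int[mu]_(s in `]x, y[) (h s)%:E <= c%:E)%E.
Proof.
move=> h0 mh c0 H.
pose F n : set T := `[x + n.+1%:R^-1, y - n.+1%:R^-1]%classic.
have Fn0 n : 0 < n.+1%:R^-1 :> R by rewrite invr_gt0.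
have -> : `]x, y[%classic = \bigcup_n F n.
  apply/seteqP; split => [s /=|s [n _]].
    rewrite in_itv/= => /andP[xs sy].
    have m0 : 0 < Num.min (s - x) (y - s) by rewrite lt_min !subr_gt0 xs.
    have [n _ /(_ n (leqnn n))] := near_infty_natSinv_lt (PosNum m0).
    rewrite /= lt_min => /andP[n1 n2]; exists n => //.
    rewrite /F/= in_itv/= -lerBrDl (ltW n1)/= lerBrDr -lerBrDl.
    exact: ltW.
  rewrite /F/= !in_itv/= => /andP[n1 n2].
  rewrite (lt_le_trans _ n1) ?ltrDl//=.
  by rewrite (le_lt_trans n2)// ltrBlDr ltrDl.
have ndF : nondecreasing_seq F.
  move=> m n mn; apply/subsetPset; apply: subset_itv; rewrite bnd_simp.
    by rewrite lerD2l lef_pV2 ?posrE// ler_nat.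
  by rewrite lerD2l lerN2 lef_pV2 ?posrE// ler_nat.
have cvgF := @ge0_nondecreasing_set_cvg_integral _ T R F (EFin \o h) mu ndF.
have {}cvgF : (\int[mu]_(s in F i) (h s)%:E)%E @[i --> \oo] -->
    (\int[mu]_(s in \bigcup_i F i) (h s)%:E)%E.
  apply: cvgF => //.
  - by move=> n; exact: measurable_itv.
  - by move=> n; apply/measurable_EFinP; exact: measurable_funTS.
  - by move=> n s _; rewrite lee_fin.
rewrite -(cvg_lim _ cvgF)//; apply: lime_le; first by apply/cvg_ex; eexists; exact: cvgF.
apply: nearW => n; rewrite /F; have := Fn0 n => n0.
(* For small [n] the segment may be empty or a single point, where the integral is zero. *)
have [uv|vu|->] := ltgtP (x + n.+1%:R^-1) (y - n.+1%:R^-1).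
- by apply: H; rewrite ?ltrDl// ltrBlDr ltrDl.
- by rewrite set_itv_ge ?bnd_simp -?ltNge// integral_set0 lee_fin.
- by rewrite set_itv1 integral_set1 lee_fin.
Qed.

Lemma FTC_is_derive (f F : R -> R) u v : u < v ->
  (forall s, u <= s <= v -> is_derive s 1 F (f s)) ->
  (forall s, u <= s <= v -> {for s, continuous f}) ->
  (\int[mu]_(s in `[u, v]) (f s)%:E = (F v - F u)%:E)%E.
Proof.
move=> uv dF cf; rewrite EFinB; apply: continuous_FTC2 => //.
- apply: continuous_in_subspaceT => s; rewrite inE/= in_itv/=; exact: cf.
- have cF s : u <= s <= v -> {for s, continuous F}.
    by move=> /dF[dFs _]; exact/differentiable_continuous/derivable1_diffP.
  split.
  + by move=> s; rewrite in_itv/= => /andP[us sv]; have [] := dF s; rewrite ?ltW.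
  + by apply: cvg_at_right_filter; apply: cF; rewrite lexx ltW.
  + by apply: cvg_at_left_filter; apply: cF; rewrite lexx ltW.
- move=> s; rewrite in_itv/= => /andP[us sv]; rewrite derive1E.
  by have [|_ ->] := dF s; rewrite ?ltW.
Qed.

Lemma powR_continuous_gt0 g x : 0 < x -> {for x, continuous (@powR R ^~ g)}.
Proof.
move=> x0; have [dp _] := is_derive1_powR g x0.
exact/differentiable_continuous/derivable1_diffP.
Qed.

(** The antiderivative is the power [1 - g] of [s - t] divided by [1 - g]. Its nonnegative value at
    [u] is discarded and [v - t] enlarged to [w], so the bound depends on neither [u] nor [v]. *)
Lemma integral_kernel_right g t u v (w : R) : 0 < g < 1 -> t < u -> u < v -> v - t <= w ->
  (\int[mu]_(s in `[u, v]) (`|s - t| `^ (- g))%:E <= (w `^ (1 - g) / (1 - g))%:E)%E.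
Proof.
move=> /andP[g0 g1] tu uv vw; have g10 : 0 < 1 - g by rewrite subr_gt0.
rewrite (eq_integral (fun s : T => ((s - t) `^ (- g))%:E)); last first.
  by move=> s; rewrite inE/= in_itv/= => /andP[us _]; rewrite gtr0_norm//; lra.
have dF s : u <= s <= v ->
    is_derive s 1 (fun s : R => (1 - g)^-1 * (s - t) `^ (1 - g)) ((s - t) `^ (- g)).
  move=> /andP[us sv]; have st : 0 < s - t by lra.
  have ds : is_derive s 1 (fun s : R => s - t) (1 - 0).
    exact: is_deriveB (is_derive_id _ _) (is_derive_cst _ _ _).
  have := is_deriveZ (1 - g)^-1 (@is_derive1_comp R (@powR R ^~ (1 - g))
    (fun s => s - t) s _ _ (is_derive1_powR (1 - g) st) ds).
  rewrite [X in is_derive _ _ _ X -> _](_ : _ = (s - t) `^ (- g))//.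
  have -> : 1 - g - 1 = - g by ring.
  by rewrite subr0 mulr1 scalerA mulVf ?scale1r// gt_eqF.
have cf s : u <= s <= v -> {for s, continuous (fun s : R => (s - t) `^ (- g))}.
  move=> /andP[us sv]; have st : 0 < s - t by lra.
  apply: (@continuous_comp _ _ _ (fun s : R => s - t) (@powR R ^~ (- g))).
    by apply: cvgB; [exact: cvg_id|exact: cvg_cst].
  exact: powR_continuous_gt0.
rewrite (FTC_is_derive uv dF cf).
rewrite lee_fin -mulrBr mulrC ler_wpM2r ?invr_ge0 ?(ltW g10)//.
apply: (@le_trans _ _ ((v - t) `^ (1 - g))); first by rewrite gerBl powR_ge0.
by apply: ge0_ler_powR; rewrite ?nnegrE; lra.
Qed.

(** Mirror image: [t] lies to the right, so the antiderivative carries a minus sign and the value at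
    [v] is the one discarded. *)
Lemma integral_kernel_left g t u v (w : R) : 0 < g < 1 -> v < t -> u < v -> t - u <= w ->
  (\int[mu]_(s in `[u, v]) (`|s - t| `^ (- g))%:E <= (w `^ (1 - g) / (1 - g))%:E)%E.
Proof.
move=> /andP[g0 g1] vt uv uw; have g10 : 0 < 1 - g by rewrite subr_gt0.
rewrite (eq_integral (fun s : T => ((t - s) `^ (- g))%:E)); last first.
  by move=> s; rewrite inE/= in_itv/= => /andP[_ sv]; rewrite distrC gtr0_norm//; lra.
have dF s : u <= s <= v ->
    is_derive s 1 (fun s : R => - (1 - g)^-1 * (t - s) `^ (1 - g)) ((t - s) `^ (- g)).
  move=> /andP[us sv]; have st : 0 < t - s by lra.
  have ds : is_derive s 1 (fun s : R => t - s) (0 - 1).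
    exact: is_deriveB (is_derive_cst _ _ _) (is_derive_id _ _).
  have := is_deriveZ (- (1 - g)^-1) (@is_derive1_comp R (@powR R ^~ (1 - g))
    (fun s => t - s) s _ _ (is_derive1_powR (1 - g) st) ds).
  rewrite [X in is_derive _ _ _ X -> _](_ : _ = (t - s) `^ (- g))//.
  have -> : 1 - g - 1 = - g by ring.
  by rewrite sub0r mulrN1 scalerN scaleNr opprK scalerA mulVf ?scale1r// gt_eqF.
have cf s : u <= s <= v -> {for s, continuous (fun s : R => (t - s) `^ (- g))}.
  move=> /andP[us sv]; have st : 0 < t - s by lra.
  apply: (@continuous_comp _ _ _ (fun s : R => t - s) (@powR R ^~ (- g))).
    by apply: cvgB; [exact: cvg_cst|exact: cvg_id].
  exact: powR_continuous_gt0.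
rewrite (FTC_is_derive uv dF cf).
rewrite lee_fin -mulrBr mulNr -mulrN opprB mulrC ler_wpM2r ?invr_ge0 ?(ltW g10)//.
apply: (@le_trans _ _ ((t - u) `^ (1 - g))); first by rewrite gerBl powR_ge0.
by apply: ge0_ler_powR; rewrite ?nnegrE; lra.
Qed.

(** The absolute value gives one symmetric weight on the plane, which equals that of the left or the
    right kernel on either side of the diagonal. *)
Lemma measurable_kernel g : measurable_fun setT (fun z : T * T => `|z.2 - z.1| `^ (- g)).
Proof.
have mB : measurable_fun setT (fun z : T * T => (z.2 : R) - z.1).
  exact: (measurable_funB measurable_snd measurable_fst).
have mN : measurable_fun setT (fun z : T * T => `|(z.2 : R) - z.1|).
  exact: (measurableT_comp (@normr_measurable R setT) mB).
exact: (measurableT_comp (measurable_powR (- g)) mN).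
Qed.

(** Each side of the singularity [t] contributes one bound with [w] equal to [b - a], hence the
    factor 2. *)
Lemma integral_kernel_le g a b t : 0 < g < 1 -> a < t < b ->
  (\int[mu]_(s in `]a, b[) (`|s - t| `^ (- g))%:E <=
     (2 * ((b - a) `^ (1 - g) / (1 - g)))%:E)%E.
Proof.
move=> g01 /andP[at_ tb]; set c := (b - a) `^ (1 - g) / (1 - g).
have c0 : 0 <= c by rewrite divr_ge0 ?powR_ge0// subr_ge0; case/andP: g01 => _ /ltW.
have mk : measurable_fun (setT : set T) (fun s => `|s - t| `^ (- g)).
  exact: (measurableT_comp (measurable_kernel g) (pair1_measurable t)).
have mkD (D : set T) : measurable_fun D (fun s => (`|s - t| `^ (- g))%:E).
  by apply/measurable_EFinP; exact: measurable_funTS.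
have -> : `]a, b[%classic = `]a, t[%classic `|` `[t, b[%classic.
  by rewrite -itv_bndbnd_setU ?bnd_simp// ltW.
rewrite ge0_integral_setU//=; last first.
  apply/disj_setPLR => s /=; rewrite !in_itv/= => /andP[_ st].
  by rewrite leNgt st.
rewrite -(integral_itv_obnd_cbnd (r := t)); last exact: mkD.
rewrite mulr_natl mulr2n EFinD; apply: leeD.
- apply: ge0_integral_oo_le => // u v au uv vt.
  apply: integral_kernel_left => //; lra.
- apply: ge0_integral_oo_le => // u v tu uv vb.
  apply: integral_kernel_right => //; lra.
Qed.

End weakly_singular_kernel.

Section fractional_by_parts.
Context {R : realType}.
Implicit Types (a b g x : R) (f y : R -> R).
Local Notation mu := (@lebesgue_measure R).
Local Notation T := (measurableTypeR R).

(** The kernel integrand at [x = b] is integrable; multiplying it by the power [g] of [b - t],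
    bounded on []a, b[] since [0 <= g], recovers [derive1 y]. *)
Lemma caputo_left_integrable_derive1 g a b y : a < b -> 0 <= g ->
  has_continuous_caputo_left g a b y ->
  mu.-integrable (`]a, b[%classic : set T) (EFin \o derive1 y).
Proof.
move=> ab g0 [ik _ _].
have bab : b \in `]a, b] by rewrite in_itv/= ab lexx.
have mD : measurable (`]a, b[%classic : set T) by exact: measurable_itv.
have mq : measurable_fun (`]a, b[%classic : set T) (fun t => (b - t) `^ g).
  apply: measurable_funTS; have mB : measurable_fun setT (fun t : T => (b - t : R)).
    exact: measurable_funB.
  exact: (measurableT_comp (measurable_powR g) mB).
have qM t : `]a, b[%classic t -> `|(b - t) `^ g| <= (b - a) `^ g.
  rewrite /= in_itv/= => /andP[at_ tb]; rewrite ger0_norm ?powR_ge0//.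
  by apply: ge0_ler_powR; rewrite ?nnegrE; lra.
have := integrable_mulr_bounded mD (ik b bab) mq qM.
apply: eq_integrable => // t; rewrite inE/= in_itv/= => /andP[at_ tb].
congr EFin; rewrite /left_kernel powRN mulrAC mulVf ?mul1r//.
by rewrite gt_eqF// powR_gt0// subr_gt0.
Qed.

(* The left and right formulas share this core: [cap] and [RL] stand for the
   Caputo derivative of [y] and the Riemann-Liouville derivative of [f], [K] and
   [I] for the underlying fractional integrals.  When [c = 0] both sides vanish,
   so positivity of the gamma function is not needed. *)
Lemma fractional_by_parts_core a b (c : R) (f y cap K RL I : R -> R) : a < b ->
  {within `[a, b], continuous f} -> abs_cont a b y ->
  mu.-integrable (`]a, b[%classic : set T) (EFin \o derive1 y) ->
  {within `[a, b], continuous cap} -> {within `[a, b], continuous RL} ->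
  (forall x, a < x < b -> cap x = c * K x) ->
  (forall x, RL x = - c * derive_in `[a, b] I x) ->
  (forall x, x \in `[a, b] -> derivable_in `[a, b] I x) ->
  \int[mu]_(x in `]a, b[) (f x * K x) = \int[mu]_(x in `]a, b[) (derive1 y x * I x) ->
  \int[mu]_(x in `]a, b[) (f x * cap x) =
  c * (y b * I b - y a * I a) + \int[mu]_(x in `]a, b[) (y x * RL x).
Proof.
move=> ab cf acy iy' ccap cRL capE RLE dI swap.
have CE x : x \in (`]a, b[%classic : set T) -> f x * cap x = c * (f x * K x).
  by rewrite inE/= in_itv/= => /capE ->; rewrite mulrCA.
have yRLE x : y x * RL x = - c * (y x * derive_in `[a, b] I x).
  by rewrite RLE mulrCA.
have [c0|c0] := eqVneq c 0.
  rewrite (@eq_Rintegral _ _ _ mu _ (fun=> 0)); last by move=> x /CE ->; rewrite c0 mul0r.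
  rewrite [X in _ + X](@eq_Rintegral _ _ _ mu _ (fun=> 0)); last first.
    by move=> x _; rewrite yRLE c0 oppr0 mul0r.
  by rewrite /Rintegral integral0 c0 mul0r add0r.
have cy := abs_cont_continuous (ltW ab) acy.
(* For [c] nonzero the derivative of [I] is [RL] divided by [- c], so it inherits continuity. *)
have cI' : {within `[a, b], continuous (derive_in `[a, b] I)}.
  have -> : derive_in `[a, b] I = (fun x => (- c)^-1 * RL x).
    by apply/funext => x; rewrite RLE mulrA mulVf ?mul1r// oppr_eq0.
  by move=> x; apply: cvgM; [exact: cvg_cst|exact: cRL].
have iyI' : mu.-integrable (`]a, b[%classic : set T)
    (fun x => (y x * derive_in `[a, b] I x)%:E).
  apply: continuous_segment_integrable => x.
  by apply: cvgM; [exact: cy|exact: cI'].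
(* Likewise [f * K] is [f * cap] divided by [c] on []a, b[], hence integrable. *)
have ifK : mu.-integrable (`]a, b[%classic : set T) (fun x => (f x * K x)%:E).
  have : mu.-integrable (`]a, b[%classic : set T) (fun x => (c^-1 * (f x * cap x))%:E).
    apply: continuous_segment_integrable => x; apply: cvgM; first exact: cvg_cst.
    by apply: cvgM; [exact: cf|exact: ccap].
  by apply: eq_integrable => // x /CE ->; rewrite mulKf.
rewrite (@eq_Rintegral _ _ _ mu _ _ _ CE) RintegralZl//.
under [X in _ + X]eq_Rintegral do rewrite yRLE.
by rewrite RintegralZl// mulNr -mulrBr swap abs_cont_by_parts.
Qed.

(** Fubini on a triangle moves the kernel from [derive1 y], the integrable factor, to [f], the
    bounded one; the core then applies with [c] the inverse of Gamma at [1 - g]. *)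
Lemma caputo_left_by_parts g a b f y : a < b -> 0 < g < 1 ->
  {within `[a, b], continuous f} -> abs_cont a b y ->
  mu.-integrable (`]a, b[%classic : set T) (EFin \o derive1 y) ->
  has_continuous_caputo_left g a b y ->
  has_continuous_RL_right g a b f ->
  \int[mu]_(x in `]a, b[) (f x * caputo_left g a y x) =
  (gamma_fun (1 - g))^-1 * (y b * right_int g b f b - y a * right_int g b f a)
  + \int[mu]_(x in `]a, b[) (y x * RL_right g a b f x).
Proof.
move=> ab g01 cf acy iy' [iky _ cC] [_ dI cRL].
apply: (fractional_by_parts_core (K := left_int g a (derive1 y)) ab cf acy iy'
  cC cRL _ (fun=> erefl) dI).
  by move=> x /andP[ax _]; rewrite /caputo_left gt_eqF.
have [M _ fM] := continuous_segment_bounded cf.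
have fM' s : `]a, b[%classic s -> `|f s| <= M.
  by rewrite /= in_itv/= => /andP[as_ sb]; rewrite fM// !ltW.
have mf := continuous_segment_measurable cf.
have k0 (z : T * T) : 0 <= `|z.2 - z.1| `^ (- g) by exact: powR_ge0.
have kC t : `]a, b[%classic t -> (\int[mu]_(s in `]a, b[) (`|s - t| `^ (- g))%:E <=
     (2 * ((b - a) `^ (1 - g) / (1 - g)))%:E)%E.
  by rewrite /= in_itv/=; exact: integral_kernel_le.
have pk x : `]a, b[%classic x ->
    mu.-integrable `]a, x[ (fun t => (derive1 y t * `|x - t| `^ (- g))%:E).
  rewrite /= in_itv/= => /andP[ax xb].
  have xab : x \in `]a, b] by rewrite in_itv/= ax ltW.
  apply: eq_integrable (iky x xab) => // t; rewrite inE/= in_itv/= => /andP[_ tx].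
  have pos : 0 < (x - t : R) by rewrite subr_gt0.
  by rewrite /left_kernel /= (gtr0_norm pos) mulrC.
have Fub := Fubini_triangle_lt iy' mf fM' (measurable_kernel g) k0 kC pk.
transitivity (\int[mu]_(s in `]a, b[)
    (f s * \int[mu]_(t in `]a, s[) (derive1 y t * `|s - t| `^ (- g)))).
  apply: eq_Rintegral => x _; congr (_ * _); apply: eq_Rintegral => t.
  rewrite inE/= in_itv/= => /andP[_ tx].
  have pos : 0 < (x - t : R) by rewrite subr_gt0.
  by rewrite /left_kernel /= (gtr0_norm pos) mulrC.
rewrite -Fub; apply: eq_Rintegral => t _; congr (_ * _).
apply: eq_Rintegral => x; rewrite inE/= in_itv/= => /andP[tx _].
have pos : 0 < (x - t : R) by rewrite subr_gt0.
by rewrite /right_kernel /= (gtr0_norm pos) mulrC.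
Qed.

(** As on the left with the triangle reversed; [c] is now minus the inverse of Gamma, whence the
    double negation in [RLE]. *)
Lemma caputo_right_by_parts g a b f y : a < b -> 0 < g < 1 ->
  {within `[a, b], continuous f} -> abs_cont a b y ->
  mu.-integrable (`]a, b[%classic : set T) (EFin \o derive1 y) ->
  has_continuous_caputo_right g a b y ->
  has_continuous_RL_left g a b f ->
  \int[mu]_(x in `]a, b[) (f x * caputo_right g b y x) =
  - (gamma_fun (1 - g))^-1 * (y b * left_int g a f b - y a * left_int g a f a)
  + \int[mu]_(x in `]a, b[) (y x * RL_left g a b f x).
Proof.
move=> ab g01 cf acy iy' [iky _ cC] [_ dI cRL].
have RLE x : RL_left g a b f x =
    - - (gamma_fun (1 - g))^-1 * derive_in `[a, b] (left_int g a f) x.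
  by rewrite opprK.
apply: (fractional_by_parts_core (K := right_int g b (derive1 y)) ab cf acy iy'
  cC cRL _ RLE dI).
  by move=> x /andP[_ xb]; rewrite /caputo_right lt_eqF.
have [M _ fM] := continuous_segment_bounded cf.
have fM' s : `]a, b[%classic s -> `|f s| <= M.
  by rewrite /= in_itv/= => /andP[as_ sb]; rewrite fM// !ltW.
have mf := continuous_segment_measurable cf.
have k0 (z : T * T) : 0 <= `|z.2 - z.1| `^ (- g) by exact: powR_ge0.
have kC t : `]a, b[%classic t -> (\int[mu]_(s in `]a, b[) (`|s - t| `^ (- g))%:E <=
     (2 * ((b - a) `^ (1 - g) / (1 - g)))%:E)%E.
  by rewrite /= in_itv/=; exact: integral_kernel_le.
have pk x : `]a, b[%classic x ->
    mu.-integrable `]x, b[ (fun t => (derive1 y t * `|x - t| `^ (- g))%:E).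
  rewrite /= in_itv/= => /andP[ax xb].
  have xab : x \in `[a, b[ by rewrite in_itv/= ltW.
  apply: eq_integrable (iky x xab) => // t; rewrite inE/= in_itv/= => /andP[xt _].
  have pos : 0 < (t - x : R) by rewrite subr_gt0.
  by rewrite /right_kernel /= distrC (gtr0_norm pos) mulrC.
have Fub := Fubini_triangle_gt iy' mf fM' (measurable_kernel g) k0 kC pk.
transitivity (\int[mu]_(s in `]a, b[)
    (f s * \int[mu]_(t in `]s, b[) (derive1 y t * `|s - t| `^ (- g)))).
  apply: eq_Rintegral => x _; congr (_ * _); apply: eq_Rintegral => t.
  rewrite inE/= in_itv/= => /andP[xt _].
  have pos : 0 < (t - x : R) by rewrite subr_gt0.
  by rewrite /right_kernel /= distrC (gtr0_norm pos) mulrC.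
rewrite -Fub; apply: eq_Rintegral => t _; congr (_ * _).
apply: eq_Rintegral => x; rewrite inE/= in_itv/= => /andP[_ xt].
have pos : 0 < (t - x : R) by rewrite subr_gt0.
by rewrite /left_kernel /= distrC (gtr0_norm pos) mulrC.
Qed.

End fractional_by_parts.

(** * The variational inequality *)

Lemma within_continuous_comp (T U V : topologicalType) (A : set T) (B : set U)
    (f : T -> U) (g : U -> V) :
  {within A, continuous f} -> {within B, continuous g} ->
  (forall x, A x -> B (f x)) -> {within A, continuous (g \o f)}.
Proof.
move=> /subspace_continuousP cf /subspace_continuousP cg AB.
apply/subspace_continuousP => x Ax W /(cg _ (AB _ Ax)).
rewrite /= !near_simpl near_withinE => gW.
have := cf _ Ax _ gW; rewrite /= !near_simpl !near_withinE.
by apply: filterS => z zW Az; apply: zW => //; exact: AB.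
Qed.

Section bracket_continuity.
Context {R : realType}.
Variables (a b al be : R) (y : R -> R).
Hypotheses (ab : a < b) (hy : frac_space al be a b y).

Lemma bracket_continuous : {within `[a, b], continuous (bracket al be a b y)}.
Proof.
have [acy [_ _ cL] [_ _ cR]] := hy.
have cy := abs_cont_continuous (ltW ab) acy.
have cid : {within `[a, b], continuous (@idfun R)}.
  by apply: continuous_subspaceT => z; exact: cvg_id.
move=> x; exact: (cvg_pair (cvg_pair (cvg_pair (cid x) (cy x)) (cL x)) (cR x)).
Qed.

Lemma bracket_comp_continuous (V : topologicalType) (F : R * R * R * R -> V) :
  {within strip a b, continuous F} ->
  {within `[a, b], continuous (fun x => F (bracket al be a b y x))}.
Proof.
move=> cF; apply: (@within_continuous_comp _ _ _ _ (strip a b) (bracket al be a b y)) => //.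
exact: bracket_continuous.
Qed.

End bracket_continuity.

Section first_variation.
Context {R : realType}.
Variables (a b al be : R) (f2 f3 f4 : R -> R).
Hypotheses (hab : a < b) (hal : 0 < al < 1) (hbe : 0 < be < 1).
Hypotheses (cf2 : {within `[a, b], continuous f2})
  (cf3 : {within `[a, b], continuous f3}) (cf4 : {within `[a, b], continuous f4}).
Hypotheses (h3 : has_continuous_RL_right al a b f3)
  (h4 : has_continuous_RL_left be a b f4).
Hypothesis EL : forall x : R, x \in `[a, b] ->
  f2 x + RL_right al a b f3 x + RL_left be a b f4 x = 0.
Local Notation mu := (@lebesgue_measure R).
Local Notation T := (measurableTypeR R).

(** With [f2], [f3], [f4] the partial derivatives of [L] along [y0], this is the linear form of the
    convexity inequality, evaluated at [w] rather than at [w - y0]. *)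
Definition first_variation (w : R -> R) (x : R) : R :=
  f2 x * w x + f3 x * caputo_left al a w x + f4 x * caputo_right be b w x.

Let D : set T := `]a, b[%classic.

Let mD : measurable D. Proof. exact: measurable_itv. Qed.

Let integrableM (f g : R -> R) : {within `[a, b], continuous f} ->
  {within `[a, b], continuous g} -> mu.-integrable D (fun x => (f x * g x)%:E).
Proof.
move=> cf cg; apply: continuous_segment_integrable => x.
by apply: cvgM; [exact: cf|exact: cg].
Qed.

Let integrableDR (f g : T -> R) : mu.-integrable D (EFin \o f) ->
  mu.-integrable D (EFin \o g) -> mu.-integrable D (fun x => (f x + g x)%:E).
Proof. by move=> i_f i_g; apply: eq_integrable (integrableD mD i_f i_g). Qed.

Lemma first_variation_integrable w : frac_space al be a b w ->
  mu.-integrable `]a, b[ (EFin \o first_variation w).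
Proof.
move=> [acw [_ _ ccL] [_ _ ccR]]; have cw := abs_cont_continuous (ltW hab) acw.
exact: (integrableDR (integrableDR (integrableM cf2 cw) (integrableM cf3 ccL))
  (integrableM cf4 ccR)).
Qed.

(** Fractional integration by parts trades the Caputo derivatives of [w] for Riemann-Liouville
    derivatives of [f3] and [f4]; the Euler-Lagrange equation then removes everything except the
    terms at [a] and [b]. *)
Lemma integral_first_variation w : frac_space al be a b w ->
  \int[mu]_(x in `]a, b[) first_variation w x =
  (gamma_fun (1 - al))^-1 * (w b * right_int al b f3 b - w a * right_int al b f3 a)
  + (- (gamma_fun (1 - be))^-1 * (w b * left_int be a f4 b - w a * left_int be a f4 a)).
Proof.
(* [u], [v], [z] are the integrals of [w] against the three Euler-Lagrange terms, [p], [q] the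
   boundary terms, [i], [j] the integrals with the Caputo derivatives. *)
have alg (u v z p q i j : R) :
    u + v + z = 0 -> i = p + v -> j = q + z -> u + i + j = p + q by lra.
move=> [acw hL hR]; have cw := abs_cont_continuous (ltW hab) acw.
have iw' : mu.-integrable D (EFin \o derive1 w).
  by apply: caputo_left_integrable_derive1 hL => //; case/andP: hal => /ltW.
have [_ _ ccL] := hL; have [_ _ ccR] := hR.
have [_ _ cR3] := h3; have [_ _ cR4] := h4.
have i2 := integrableM cf2 cw.
have i3 := integrableM cf3 ccL.
have i4 := integrableM cf4 ccR.
have ir3 := integrableM cw cR3.
have ir4 := integrableM cw cR4.
have i23 := integrableDR i2 i3.
have i2r := integrableDR i2 ir3.
have EL0 : \int[mu]_(x in D) (f2 x * w x + w x * RL_right al a b f3 x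
    + w x * RL_left be a b f4 x) = 0.
  rewrite (@eq_Rintegral _ _ _ mu _ (fun=> 0)); first by rewrite /Rintegral integral0.
  move=> x; rewrite inE/= => /subset_itv_oo_cc xab.
  by rewrite (mulrC (f2 x)) -!mulrDr EL// mulr0.
rewrite (RintegralD mD i2r ir4) (RintegralD mD i2 ir3) in EL0.
rewrite /first_variation (RintegralD mD i23 i4) (RintegralD mD i2 i3).
exact: alg EL0 (caputo_left_by_parts hab hal cf3 acw iw' hL h3)
  (caputo_right_by_parts hab hbe cf4 acw iw' hR h4).
Qed.

End first_variation.

Theorem theorem3p9 (R : realType) (a b al be : R)
    (L : R * R * R * R -> R) (y0 : R -> R)
    (hab : a < b) (hal : 0 < al < 1) (hbe : 0 < be < 1)
    (hC1 : C1_on_strip a b L)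
    (hconv : convex_yuv (strip a b) L)
    (hy0 : frac_space al be a b y0)
    (h3 : has_continuous_RL_right al a b
            (fun x => partial3 L (bracket al be a b y0 x)))
    (h4 : has_continuous_RL_left be a b
            (fun x => partial4 L (bracket al be a b y0 x)))
    (hEL : forall x : R, x \in `[a, b] ->
       partial2 L (bracket al be a b y0 x)
       + RL_right al a b (fun t => partial3 L (bracket al be a b y0 t)) x
       + RL_left be a b (fun t => partial4 L (bracket al be a b y0 t)) x = 0) :
  forall y : R -> R, frac_space al be a b y ->
    y a = y0 a -> y b = y0 b ->
    J_functional al be a b L y0 <= J_functional al be a b L y.
Proof.
move=> y hy ya yb.
(* [j], [j0] are the values of the functional, [v], [v0] the integrated first variations, [dj], [dv]
   the integrals of the differences. *)
have le_of_diff (j j0 v v0 dj dv : R) : v = v0 -> dj = j - j0 ->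
    dv = v - v0 -> dv <= dj -> j0 <= j by lra.
have alg (u v z p q r p' q' r' : R) : (u * p + v * q + z * r) - (u * p' + v * q' + z * r') =
  u * (p - p') + v * (q - q') + z * (r - r') by ring.
have [cL _ _ _] := hC1.
have [[_ [c2 c3 c4]] conv] := hconv.
(* Convexity restated for two given points instead of a point and an increment. *)
have conv' x w u v w' u' v' : strip a b (x, w, u, v) -> strip a b (x, w', u', v') ->
    partial2 L (x, w, u, v) * (w' - w) + partial3 L (x, w, u, v) * (u' - u)
      + partial4 L (x, w, u, v) * (v' - v) <= L (x, w', u', v') - L (x, w, u, v).
  have := conv x w u v (w' - w) (u' - u) (v' - v).
  by rewrite (subrKC w) (subrKC u) (subrKC v).
have cf2 := bracket_comp_continuous hab hy0 c2.
have cf3 := bracket_comp_continuous hab hy0 c3.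
have cf4 := bracket_comp_continuous hab hy0 c4.
have mD : measurable (`]a, b[%classic : set (measurableTypeR R)).
  exact: measurable_itv.
have IG := integral_first_variation hab hal hbe cf2 cf3 cf4 h3 h4 hEL.
have iG := first_variation_integrable hab cf2 cf3 cf4.
(* Equal boundary values make the integrated first variations at [y] and [y0] coincide. *)
have {}IG := etrans (IG y hy) (etrans _ (esym (IG y0 hy0))).
rewrite ya yb in IG; move: (IG erefl) => {}IG.
have iy := iG _ _ y hy; have iy0 := iG _ _ y0 hy0.
have JE w : frac_space al be a b w ->
    J_functional al be a b L w =
      \int[@lebesgue_measure R]_(x in `]a, b[) L (bracket al be a b w x).
  move=> hw; congr fine; apply: integral_itv_bndoo.
  have cLw := bracket_comp_continuous hab hw cL.
  by apply/measurable_EFinP; exact: (continuous_segment_measurable cLw).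
have iL w : frac_space al be a b w ->
    (@lebesgue_measure R).-integrable `]a, b[ (fun x => (L (bracket al be a b w x))%:E).
  move=> hw; have cLw := bracket_comp_continuous hab hw cL.
  exact: (continuous_segment_integrable cLw).
rewrite (JE y hy) (JE y0 hy0).
apply: (le_of_diff _ _ _ _ _ _ IG (RintegralB mD (iL y hy) (iL y0 hy0))
  (RintegralB mD iy iy0)).
apply: (le_Rintegral mD).
- exact: eq_integrable (integrableB mD iy iy0).
- exact: eq_integrable (integrableB mD (iL y hy) (iL y0 hy0)).
move=> x /subset_itv_oo_cc xab.
(* Pointwise, the difference of the two first variations regroups into increments of the values of
   [y] and of its Caputo derivatives, which is the convexity inequality along [y0]. *)
rewrite /first_variation alg; exact: conv'.
Qed.
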